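(* Let $G=\mathrm{Aut}(\mathfrak{so}(8))$, and let $F_{13},F_{17},F_{18},F_{19},F_{20},F_{22}$ be the finite abelian subgroups of $\mathrm{O}(8)/\langle -I\rangle\subset G$ defined in the context. With $W(F)=N_G(F)/C_G(F)$, one has $$|W(F_{17})|=3^2\times 2^{10},\quad |W(F_{18})|=3\times 2^7,\quad |W(F_{19})|=2^9,\quad |W(F_{20})|=2^8,$$ and $W(F_{13})\cong W(F_{22})\cong S_8$.
   Context: $\mathfrak{so}(8)$ is the compact real Lie algebra, and $\mathrm{O}(8)/\langle -I\rangle$ is regarded as a subgroup of $G$ via conjugation on $\mathfrak{so}(8)$. $[X]$ is the class of $X\in\mathrm{O}(8)$ in $\mathrm{O}(8)/\langle -I\rangle$. Put $I_{p,q}=\mathrm{diag}(-I_p,I_q)$, $J_n=\left(\begin{array}{cc}0&I_n\\ -I_n&0\end{array}\right)$, $J'_n=\left(\begin{array}{cc}0&I_n\\ I_n&0\end{array}\right)$. Abbreviate $D=[\mathrm{diag}\{I_{1,1},I_{1,1},I_{1,1},I_{1,1}\}]$, $E=[\mathrm{diag}\{J'_1,J'_1,J'_1,J'_1\}]$. Then $F_{13}=\langle[I_{4,4}],[J'_4],[\mathrm{diag}\{I_{2,2},I_{2,2}\}],[\mathrm{diag}\{J'_2,J'_2\}],D,E\rangle$, $F_{17}=\langle[I_{4,4}],[I_{2,6}],[I_{6,2}],D,E\rangle$, $F_{18}=\langle[I_{4,4}],[I_{2,6}],[I_{6,2}],D,[\mathrm{diag}\{J'_1,J'_1,J'_1,J_1\}]\rangle$,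 $F_{19}=\langle[I_{4,4}],[I_{2,6}],[I_{6,2}],D,[\mathrm{diag}\{J'_1,J'_1,J_1,J_1\}]\rangle$, $F_{20}=\langle[I_{4,4}],[I_{2,6}],[I_{6,2}],[\mathrm{diag}\{I_{1,1},I_{1,1},I_{1,1},J_1\}],[\mathrm{diag}\{J'_1,J'_1,J_1,I_{1,1}\}]\rangle$, and $F_{22}$ is the subgroup of (classes of) diagonal matrices in $\mathrm{O}(8)/\langle -I\rangle$. *)

(* Defs.v *)
From HB Require Import structures.
From mathcomp Require Import all_boot all_order all_algebra all_fingroup.
From mathcomp Require Import generic_quotient.
From mathcomp Require Import boolp classical_sets functions cardinality reals.

Set Implicit Arguments.
Unset Strict Implicit.
Unset Printing Implicit Defensive.

Import GRing.Theory.
Local Open Scope ring_scope.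
Local Open Scope classical_set_scope.
Local Open Scope quotient_scope.

Local Notation "x *g y" := (x * y)%g (at level 40, left associativity).

(* The groups are infinite, so they live in [groupType] rather than in
   [finGroupType]; quotients of such groups are not in the library. *)

Section QuotientGroup.

Record normal_subgroup (H : groupType) := NormalSubgroup {
  normal_pred :> {pred H};
  normal_group : group_closed normal_pred;
  normal_conj : forall x y : H,
    x \in normal_pred -> (x ^ y)%g \in normal_pred
}.

Variables (H : groupType) (N : normal_subgroup H).

Let N1 : 1%g \in normal_pred N. Proof. by case: (normal_group N). Qed.
Let NV x : x \in normal_pred N -> x^-1%g \in normal_pred N.
Proof. exact: group_closedV (normal_group N) x. Qed.
Let NM x y : x \in normal_pred N -> y \in normal_pred N ->
  x *g y \in normal_pred N.
Proof. exact: (group_closedM (normal_group N)). Qed.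

Definition same_coset (x y : H) : bool := x^-1%g *g y \in normal_pred N.

Lemma same_coset_refl : reflexive same_coset.
Proof. by move=> x; rewrite /same_coset mulVg. Qed.

Lemma same_coset_sym : symmetric same_coset.
Proof.
by move=> x y; apply/idP/idP => /NV; rewrite /same_coset invgM invgK.
Qed.

Lemma same_coset_trans : transitive same_coset.
Proof.
move=> y x z xy yz; have := NM xy yz.
by rewrite /same_coset mulgA mulgK.
Qed.

Canonical same_coset_equiv :=
  EquivRel same_coset same_coset_refl same_coset_sym same_coset_trans.

Definition quotg := {eq_quot same_coset_equiv}.

HB.instance Definition _ := Choice.on quotg.
HB.instance Definition _ := EqQuotient.on quotg.

Lemma quotgP (x y : H) :
  reflect (\pi_quotg x = \pi_quotg y)%qT (x^-1%g *g y \in normal_pred N).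
Proof. by apply: (iffP idP) => [xy|/eqmodP //]; apply/eqmodP. Qed.

Definition quotg_mul (a b : quotg) : quotg := (\pi_quotg (repr a *g repr b))%qT.
Definition quotg_one : quotg := (\pi_quotg 1%g)%qT.
Definition quotg_inv (a : quotg) : quotg := (\pi_quotg (repr a)^-1%g)%qT.

Lemma pi_quotg_mul (x y : H) :
  quotg_mul (\pi_quotg x)%qT (\pi_quotg y)%qT = (\pi_quotg (x *g y))%qT.
Proof.
apply/quotgP.
have /quotgP Nx : (\pi_quotg (repr (\pi_quotg x)) = \pi_quotg x)%qT.
  by rewrite reprK.
have /quotgP Ny : (\pi_quotg (repr (\pi_quotg y)) = \pi_quotg y)%qT.
  by rewrite reprK.
set x' := repr _ in Nx *; set y' := repr _ in Ny *.
have := NM (normal_conj y' Nx) Ny.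
by rewrite conjgE invgM !mulgA mulgK.
Qed.

Lemma pi_quotg_inv (x : H) : quotg_inv (\pi_quotg x)%qT = (\pi_quotg x^-1%g)%qT.
Proof.
apply/quotgP.
have /quotgP Nx : (\pi_quotg (repr (\pi_quotg x)) = \pi_quotg x)%qT.
  by rewrite reprK.
set x' := repr _ in Nx *.
have := NV (normal_conj x'^-1%g Nx).
by rewrite conjgE !invgM !invgK !mulgA mulgK.
Qed.

Lemma quotg_mulA : associative quotg_mul.
Proof.
move=> a b c; rewrite -[a]reprK -[b]reprK -[c]reprK.
rewrite (pi_quotg_mul (repr b)) (pi_quotg_mul (repr a) (repr b)).
by rewrite (pi_quotg_mul (repr a)) (pi_quotg_mul (_ *g _)) mulgA.
Qed.

Lemma quotg_mul1 : left_id quotg_one quotg_mul.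
Proof. by move=> a; rewrite -[a]reprK pi_quotg_mul mul1g. Qed.

Lemma quotg_mulr1 : right_id quotg_one quotg_mul.
Proof. by move=> a; rewrite -[a]reprK pi_quotg_mul mulg1. Qed.

Lemma quotg_mulV : left_inverse quotg_one quotg_inv quotg_mul.
Proof. by move=> a; rewrite -[a]reprK pi_quotg_inv pi_quotg_mul mulVg. Qed.

Lemma quotg_mulrV : right_inverse quotg_one quotg_inv quotg_mul.
Proof. by move=> a; rewrite -[a]reprK pi_quotg_inv pi_quotg_mul mulgV. Qed.

HB.instance Definition _ := isGroup.Build quotg
  quotg_mulA quotg_mul1 quotg_mulr1 quotg_mulV quotg_mulrV.

Lemma pi_quotgM (x y : H) :
  (\pi_quotg (x *g y))%qT = (\pi_quotg x)%qT *g (\pi_quotg y)%qT.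
Proof. by rewrite -[RHS]/(quotg_mul _ _) pi_quotg_mul. Qed.

End QuotientGroup.

Arguments quotg {H} N.

Definition group_isom (H K : groupType) : Prop :=
  exists2 f : H -> K, {morph f : x y / x *g y} & bijective f.

Definition gen (G : groupType) (S : set G) : set G :=
  smallest [set K : set G | group_closed (mem K)] S.

Section WeylGroup.
Variables (G : groupType) (F : set G).

Definition normalizer : {pred G} :=
  [pred g : G | `[< [set g *g x *g g^-1%g | x in F] = F >]].

Definition centralizer : {pred G} :=
  [pred g : G | `[< forall x, F x -> commute g x >]].

Lemma normalizerP g :
  reflect ([set g *g x *g g^-1%g | x in F] = F) (g \in normalizer).
Proof. exact: asboolP. Qed.

Lemma centralizerP g :
  reflect (forall x, F x -> commute g x) (g \in centralizer).
Proof. exact: asboolP. Qed.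

Lemma normalizer_group : group_closed normalizer.
Proof.
split.
  apply/normalizerP/seteqP; split => x.
    by move=> [y Fy <-]; rewrite mul1g invg1 mulg1.
  by move=> Fx; exists x => //; rewrite mul1g invg1 mulg1.
move=> g h /normalizerP Ng /normalizerP Nh; apply/normalizerP.
have NhV : [set h^-1%g *g x *g h | x in F] = F.
  apply/seteqP; split => x.
    move=> [y + <-]; rewrite -{1}Nh => -[z Fz <-].
    by rewrite !mulgA mulVg mul1g mulgVK.
  move=> Fx; exists (h *g x *g h^-1%g); last by rewrite !mulgA mulVg mul1g mulgVK.
  by rewrite -Nh; exists x.
apply/seteqP; split => x.
  move=> [y Fy <-] /=; rewrite invgM invgK !mulgA -Ng.
  exists (h^-1%g *g y *g h); last by rewrite !mulgA.
  by rewrite -NhV; exists y.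
move=> Fx; have : [set g *g y *g g^-1%g | y in F] x by rewrite Ng.
move=> [y + <-]; rewrite -{1}NhV => -[z Fz <-].
by exists z => //=; rewrite invgM invgK !mulgA.
Qed.

Lemma centralizer_group : group_closed centralizer.
Proof.
split; first by apply/centralizerP => x _; apply/esym/commute1.
move=> g h /centralizerP Cg /centralizerP Ch; apply/centralizerP => x Fx.
by apply/commute_sym/commuteM;
  [exact/commute_sym/Cg | exact/commuteV/commute_sym/Ch].
Qed.

Record normalizer_group_of := NormalizerElt {
  normalizer_val :> G;
  _ : normalizer_val \in normalizer
}.

HB.instance Definition _ := [isSub for normalizer_val].
HB.instance Definition _ := [Choice of normalizer_group_of by <:].
HB.instance Definition _ := SubChoice_isSubGroup.Build G normalizer
  normalizer_group_of normalizer_group.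

Definition centralizer_in_normalizer : {pred normalizer_group_of} :=
  [pred g | val g \in centralizer].

Lemma centralizer_in_group : group_closed centralizer_in_normalizer.
Proof.
have [C1 CD] := centralizer_group.
split; first exact: C1.
by move=> g h Cg Ch; exact: (CD _ _ Cg Ch).
Qed.

Lemma centralizer_in_conj (x y : normalizer_group_of) :
  x \in centralizer_in_normalizer ->
  (x ^ y)%g \in centralizer_in_normalizer.
Proof.
move=> /centralizerP Cx; apply/centralizerP => z Fz.
have /normalizerP Ny : val y \in normalizer by exact: valP.
rewrite -[val (x ^ y)%g]/((val y)^-1%g *g (val x *g val y)).
have := Cx (val y *g z *g (val y)^-1%g).
have Fyz : F (val y *g z *g (val y)^-1%g) by rewrite -Ny; exists z.
move=> /(_ Fyz); rewrite /commute => e.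
have := congr1 (fun t => (val y)^-1%g *g t *g val y) e.
by rewrite !mulgA mulVg mul1g !mulgVK.
Qed.

Definition normalized_centralizer : normal_subgroup normalizer_group_of :=
  NormalSubgroup centralizer_in_group centralizer_in_conj.

(* N_G(F) / C_G(F) *)
Definition W := quotg normalized_centralizer.

HB.instance Definition _ := Group.on W.

End WeylGroup.

Section Orthogonal.
Variable R : realType.

Record ortho (n : nat) := Ortho {
  ortho_mx :> 'M[R]_n;
  _ : ortho_mx *m ortho_mx^T == 1%:M
}.

Section OrthoGroup.
Variable n : nat.

HB.instance Definition _ := [isSub for @ortho_mx n].
HB.instance Definition _ := [Choice of ortho n by <:].

Implicit Types X Y Z : ortho n.

Lemma orthoP X : X *m X^T = 1%:M.
Proof. by case: X => X /= /eqP. Qed.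

Lemma orthoTP X : X^T *m X = 1%:M.
Proof. exact: mulmx1C (orthoP X). Qed.

Fact ortho_one_subproof : (1%:M : 'M[R]_n) *m 1%:M^T == 1%:M.
Proof. by rewrite trmx1 mulmx1. Qed.

Fact ortho_mul_subproof X Y : (X *m Y) *m (X *m Y)^T == 1%:M.
Proof. by rewrite trmx_mul mulmxA -(mulmxA X) orthoP mulmx1 orthoP. Qed.

Fact ortho_inv_subproof X : X^T *m X^T^T == 1%:M.
Proof. by rewrite trmxK orthoTP. Qed.

Fact ortho_opp_subproof X : (- ortho_mx X) *m (- ortho_mx X)^T == 1%:M.
Proof. by rewrite linearN /= mulmxN mulNmx opprK orthoP. Qed.

Definition ortho_one := Ortho ortho_one_subproof.
Definition ortho_mul X Y := Ortho (ortho_mul_subproof X Y).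
Definition ortho_inv X := Ortho (ortho_inv_subproof X).
Definition ortho_opp X := Ortho (ortho_opp_subproof X).

Fact ortho_mulA : associative ortho_mul.
Proof. by move=> X Y Z; apply: val_inj; rewrite /= mulmxA. Qed.
Fact ortho_mul1 : left_id ortho_one ortho_mul.
Proof. by move=> X; apply: val_inj; rewrite /= mul1mx. Qed.
Fact ortho_mulr1 : right_id ortho_one ortho_mul.
Proof. by move=> X; apply: val_inj; rewrite /= mulmx1. Qed.
Fact ortho_mulV : left_inverse ortho_one ortho_inv ortho_mul.
Proof. by move=> X; apply: val_inj; rewrite /= orthoTP. Qed.
Fact ortho_mulrV : right_inverse ortho_one ortho_inv ortho_mul.
Proof. by move=> X; apply: val_inj; rewrite /= orthoP. Qed.

HB.instance Definition _ := isGroup.Build (ortho n)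
  ortho_mulA ortho_mul1 ortho_mulr1 ortho_mulV ortho_mulrV.

Definition ortho_m1 : ortho n := ortho_opp 1%g.

Definition gen_m1 : {pred ortho n} := mem (gen [set ortho_m1]).

Lemma ortho_m1M X : ortho_m1 *g X = ortho_opp X.
Proof. by apply: val_inj; rewrite /= mulNmx mul1mx. Qed.

Lemma gen_m1E X : (X \in gen_m1) = (X == 1%g) || (X == ortho_m1).
Proof.
have m1V : ortho_m1^-1%g = ortho_m1.
  by apply: val_inj; rewrite /= linearN /= trmx1.
have m1K : ortho_m1 *g ortho_m1 = 1%g.
  by apply: val_inj; rewrite /= mulNmx mulmxN mulmx1 opprK.
apply/idP/idP.
  rewrite inE => /(_ [set X | (X == 1%g) || (X == ortho_m1)]).
  apply; split; last by move=> Y ->; rewrite /= eqxx orbT.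
  split; first by rewrite !inE /= eqxx.
  move=> Y Z; rewrite !inE /= => /orP[]/eqP-> /orP[]/eqP->;
    by rewrite ?invg1 ?m1V ?mulg1 ?mul1g ?m1K eqxx ?orbT.
move=> XE; rewrite inE => K [[K1 KD] /(_ ortho_m1 erefl) Km].
case/orP: XE => /eqP ->; first by move: K1; rewrite inE.
exact: Km.
Qed.

Fact gen_m1_group : group_closed gen_m1.
Proof.
split.
  rewrite inE => K [[K1 _] _]; move: K1; by rewrite inE.
move=> X Y; rewrite !inE => gX gY K KP.
have [[_ KD] _] := KP.
have := KD X Y; rewrite !inE; apply; [exact: gX | exact: gY].
Qed.

Fact gen_m1_conj X Y : X \in gen_m1 -> (X ^ Y)%g \in gen_m1.
Proof.
rewrite !gen_m1E => /orP[]/eqP->; first by rewrite conj1g eqxx.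
suff -> : (ortho_m1 ^ Y)%g = ortho_m1 by rewrite eqxx orbT.
apply: val_inj; rewrite /= mulNmx mul1mx mulmxN.
by rewrite orthoTP.
Qed.

Definition pm1 : normal_subgroup (ortho n) :=
  NormalSubgroup gen_m1_group gen_m1_conj.

(* O(n)/<-I> *)
Definition PO := quotg pm1.

HB.instance Definition _ := Group.on PO.
HB.instance Definition _ := EqQuotient.on PO.

Definition cls (X : ortho n) : PO := (\pi_PO X)%qT.

Lemma clsK (a : PO) : cls (repr a) = a.
Proof. exact: reprK. Qed.

Lemma clsM X Y : cls (X *g Y) = cls X *g cls Y.
Proof. exact: pi_quotgM. Qed.

End OrthoGroup.

Section Blocks.
Variables p q : nat.

Fact ortho_diag_subproof (X : ortho p) (Y : ortho q) :
  block_mx X 0 0 Y *m (block_mx X 0 0 Y)^T == 1%:M.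
Proof.
rewrite tr_block_mx mulmx_block !trmx0 !mulmx0 !mul0mx !addr0 !add0r !orthoP.
by rewrite -scalar_mx_block.
Qed.

Definition ortho_diag X Y : ortho (p + q) := Ortho (ortho_diag_subproof X Y).

Fact Ipq_subproof :
  (block_mx (- 1%:M) 0 0 1%:M : 'M[R]_(p + q)) *m
  (block_mx (- 1%:M) 0 0 1%:M)^T == 1%:M.
Proof.
rewrite tr_block_mx mulmx_block linearN /= !trmx1 !trmx0 !mulmx0 !mul0mx.
by rewrite !addr0 !add0r mulmxN mulNmx opprK !mulmx1 -scalar_mx_block.
Qed.

Definition Ipq : ortho (p + q) := Ortho Ipq_subproof.

Fact Jn_subproof :
  (block_mx 0 1%:M (- 1%:M) 0 : 'M[R]_(p + p)) *m
  (block_mx 0 1%:M (- 1%:M) 0)^T == 1%:M.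
Proof.
rewrite tr_block_mx mulmx_block linearN /= !trmx1 !trmx0 !mulmx0 !mul0mx.
by rewrite !addr0 !add0r mulmxN mulNmx opprK !mulmx1 -scalar_mx_block.
Qed.

Definition Jn : ortho (p + p) := Ortho Jn_subproof.

Fact Jn'_subproof :
  (block_mx 0 1%:M 1%:M 0 : 'M[R]_(p + p)) *m
  (block_mx 0 1%:M 1%:M 0)^T == 1%:M.
Proof.
rewrite tr_block_mx mulmx_block /= !trmx1 !trmx0 !mulmx0 !mul0mx.
by rewrite !addr0 !add0r !mulmx1 -scalar_mx_block.
Qed.

Definition Jn' : ortho (p + p) := Ortho Jn'_subproof.

End Blocks.

Definition ortho_diag4 p q r s
    (A : ortho p) (B : ortho q) (C : ortho r) (D : ortho s) :=
  ortho_diag (ortho_diag A B) (ortho_diag C D).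

End Orthogonal.

Arguments Ipq {R} p q.
Arguments Jn {R} p.
Arguments Jn' {R} p.

Section SpecialOrthogonalLieAlgebra.
Variables (R : realType) (n : nat).

Definition skew : {pred 'M[R]_n} := [pred A : 'M[R]_n | A^T == - A].

Fact skew_submod_closed : submod_closed skew.
Proof.
split; first by rewrite inE trmx0 oppr0.
move=> a A B; rewrite !inE => /eqP As /eqP Bs.
by rewrite linearD linearZ /= As Bs opprD scalerN.
Qed.

HB.instance Definition _ := GRing.isSubmodClosed.Build R 'M[R]_n skew
  skew_submod_closed.

Record so := So { so_mx :> 'M[R]_n; _ : so_mx \in skew }.

HB.instance Definition _ := [isSub for so_mx].
HB.instance Definition _ := [Choice of so by <:].
HB.instance Definition _ := [SubChoice_isSubLmodule of so by <:].

Lemma soP (A : so) : A^T = - A.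
Proof. by case: A => A /= /eqP. Qed.

Fact lie_subproof (A B : so) : A *m B - B *m A \in skew.
Proof.
rewrite inE linearB /= !trmx_mul !soP !mulNmx !mulmxN !opprK.
by rewrite opprB.
Qed.

Definition lie (A B : so) : so := So (lie_subproof A B).

Definition is_lie_aut (f : so -> so) : Prop :=
  [/\ linear f, bijective f & {morph f : A B / lie A B}].

Record aut_so := AutSo { aut_fun :> so -> so; _ : `[< is_lie_aut aut_fun >] }.

HB.instance Definition _ := [isSub for aut_fun].
HB.instance Definition _ := [Choice of aut_so by <:].

Lemma aut_soP (f : aut_so) : is_lie_aut f.
Proof. by case: f => f /= /asboolP. Qed.

Fact aut_one_subproof : `[< is_lie_aut idfun >].
Proof. by apply/asboolP; split=> //; exists idfun. Qed.

Fact aut_mul_subproof (f g : aut_so) : `[< is_lie_aut (f \o g) >].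
Proof.
have [fl fb fm] := aut_soP f; have [gl gb gm] := aut_soP g.
apply/asboolP; split; last by move=> A B; rewrite /= gm fm.
  by move=> a A B; rewrite /= gl fl.
exact: bij_comp.
Qed.

Definition aut_inv_fun (f : aut_so) (B : so) : so :=
  xget 0 [set A | f A = B].

Lemma aut_invK (f : aut_so) : cancel (aut_inv_fun f) f.
Proof.
move=> B; rewrite /aut_inv_fun; case: xgetP => [A _ //|/= no].
by have [_ [g gK fK] _] := aut_soP f; case: (no (g B)); exact: fK.
Qed.

Lemma aut_funK (f : aut_so) : cancel f (aut_inv_fun f).
Proof.
have [_ /bij_inj fI _] := aut_soP f.
by move=> A; apply: fI; rewrite aut_invK.
Qed.

Fact aut_inv_subproof (f : aut_so) : `[< is_lie_aut (aut_inv_fun f) >].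
Proof.
have [fl /[dup] fb /bij_inj fI fm] := aut_soP f.
apply/asboolP; split.
- by move=> a A B; apply: fI; rewrite fl !aut_invK.
- by exists f; [exact: aut_invK | exact: aut_funK].
- by move=> A B; apply: fI; rewrite fm !aut_invK.
Qed.

Definition aut_one := AutSo aut_one_subproof.
Definition aut_mul f g := AutSo (aut_mul_subproof f g).
Definition aut_inv f := AutSo (aut_inv_subproof f).

Fact aut_mulA : associative aut_mul.
Proof. by move=> f g h; apply: val_inj. Qed.
Fact aut_mul1 : left_id aut_one aut_mul.
Proof. by move=> f; apply: val_inj. Qed.
Fact aut_mulr1 : right_id aut_one aut_mul.
Proof. by move=> f; apply: val_inj. Qed.
Fact aut_mulV : left_inverse aut_one aut_inv aut_mul.
Proof. by move=> f; apply/val_inj/funext => A; exact: aut_funK. Qed.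
Fact aut_mulrV : right_inverse aut_one aut_inv aut_mul.
Proof. by move=> f; apply/val_inj/funext => A; exact: aut_invK. Qed.

HB.instance Definition _ := isGroup.Build aut_so
  aut_mulA aut_mul1 aut_mulr1 aut_mulV aut_mulrV.

Fact conj_so_subproof (X : ortho R n) (A : so) : X *m A *m X^T \in skew.
Proof. by rewrite inE !trmx_mul trmxK soP mulNmx mulmxN mulmxA. Qed.

Definition conj_so X A := So (conj_so_subproof X A).

Lemma conj_so_comp (X Y : ortho R n) A :
  conj_so X (conj_so Y A) = conj_so (X *g Y) A.
Proof. by apply: val_inj; rewrite /= trmx_mul !mulmxA. Qed.

Lemma conj_so1 A : conj_so 1%g A = A.
Proof. by apply: val_inj; rewrite /= trmx1 mul1mx mulmx1. Qed.

Fact Ad_subproof (X : ortho R n) : `[< is_lie_aut (conj_so X) >].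
Proof.
apply/asboolP; split.
- move=> a A B; apply: val_inj => /=.
  by rewrite mulmxDr mulmxDl -scalemxAr -scalemxAl.
- exists (conj_so X^-1%g) => A; rewrite conj_so_comp ?mulVg ?mulgV;
    exact: conj_so1.
- move=> A B; apply: val_inj => /=.
  rewrite mulmxBr mulmxBl !mulmxA; congr (_ - _).
    by rewrite -(mulmxA _ X^T X) orthoTP mulmx1.
  by rewrite -(mulmxA _ X^T X) orthoTP mulmx1.
Qed.

Definition Ad (X : ortho R n) : aut_so := AutSo (Ad_subproof X).

Lemma AdM (X Y : ortho R n) : Ad (X *g Y) = Ad X *g Ad Y.
Proof. by apply/val_inj/funext => A /=; rewrite -conj_so_comp. Qed.

Lemma Ad_opp (X : ortho R n) : Ad (ortho_opp X) = Ad X.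
Proof.
apply/val_inj/funext => A; apply: val_inj => /=.
by rewrite linearN /= mulmxN !mulNmx opprK.
Qed.

(* The choice of representative is immaterial by [AdPO_cls], and for n > 2
   [AdPO_inj] identifies O(n)/<-I> with a subgroup of Aut(so(n)). *)
Definition AdPO (a : PO R n) : aut_so := Ad (repr a).

Lemma AdPO_cls (X : ortho R n) : AdPO (cls X) = Ad X.
Proof.
have : (\pi_(PO R n) (repr (cls X)) = \pi_(PO R n) X)%qT by rewrite reprK.
rewrite /AdPO; move: (repr _) => Y /quotgP.
rewrite -[normal_pred _]/(@gen_m1 R n) gen_m1E => /orP[] /eqP YX.
  by rewrite -[X](mulKg Y^-1%g) invgK YX mulg1.
have -> : X = ortho_opp Y.
  rewrite -(mulKg Y^-1%g X) invgK YX.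
  by apply: val_inj; rewrite /= mulmxN mulmx1.
by rewrite Ad_opp.
Qed.

Lemma AdPO_M (a b : PO R n) : AdPO (a *g b) = AdPO a *g AdPO b.
Proof.
by rewrite -[a]clsK -[b]clsK -clsM !AdPO_cls AdM.
Qed.

Fact elem_so_subproof (i j : 'I_n) :
  (delta_mx i j - delta_mx j i : 'M[R]_n) \in skew.
Proof. by rewrite inE linearB /= !trmx_delta opprB. Qed.

Definition elem_so i j := So (elem_so_subproof i j).

Lemma AdPO_inj : (2 < n)%N -> injective AdPO.
Proof.
move=> n2 a b; rewrite -[a]clsK -[b]clsK !AdPO_cls.
move: (repr a) (repr b) => {a b} X Y XY; apply/quotgP.
rewrite -[normal_pred _]/(@gen_m1 R n) gen_m1E.
have AdZ : Ad (X^-1%g *g Y) = 1%g.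
  by rewrite AdM -XY -AdM mulVg; apply/val_inj/funext => A; exact: conj_so1.
move: (_ *g Y) AdZ => {X Y XY} Z AdZ.
have ZA (A : so) : Z *m A = A *m Z.
  have /(congr1 (fun f : aut_so => so_mx (f A))) /= := AdZ.
  by move=> {2}<-; rewrite -mulmxA orthoTP mulmx1.
have Zij (i j k l : 'I_n) : Z k i *+ (j == l) - Z k j *+ (i == l) =
    Z j l *+ (k == i) - Z i l *+ (k == j).
  have /matrixP/(_ k l) := ZA (elem_so i j).
  rewrite /= mulmxBr mulmxBl !mxE.
  have cE (p q : 'I_n) : \sum_r Z k r * delta_mx p q r l = Z k p *+ (q == l).
    rewrite (bigD1 p) //= big1 ?addr0; last first.
      by move=> r /negPf rp; rewrite mxE rp mulr0.
    by rewrite mxE eqxx /= mulr_natr eq_sym.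
  have rE (p q : 'I_n) : \sum_r delta_mx p q k r * Z r l = Z q l *+ (k == p).
    rewrite (bigD1 q) //= big1 ?addr0; last first.
      by move=> r /negPf rq; rewrite mxE rq andbF mul0r.
    by rewrite mxE eqxx andbT mulr_natl.
  by rewrite !cE !rE.
have Z0 (k i : 'I_n) : k != i -> Z k i = 0.
  move=> ki; have [j /andP[/negPf jk /negPf ji]] : exists j, (j != k) && (j != i).
    apply/existsP; apply: contraLR n2; rewrite negb_exists => /forallP no.
    rewrite -leqNgt -[n]card_ord.
    have <- : #|[set k; i]%SET| = 2%N by rewrite cards2 ki.
    apply/subset_leq_card/fintype.subsetP => j _; rewrite !finset.inE.
    by have := no j; rewrite negb_and !negbK.
  have := Zij i j k j; rewrite eqxx (eq_sym i) ji (negPf ki) (eq_sym k) jk.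
  by rewrite !mulr0n !subr0.
have Zd (i j : 'I_n) : i != j -> Z i i = Z j j.
  move=> /negPf ij; have := Zij i j i j.
  by rewrite !eqxx ij !mulr0n !subr0 !mulr1n.
pose i0 := Ordinal (ltn_trans (isT : (0 < 2)%N) n2).
have ZE : Z = (Z i0 i0)%:M :> 'M_n.
  apply/matrixP => i j; rewrite mxE.
  have [<-|/Z0 -> //] := eqVneq i j.
  by have [->//|/Zd->] := eqVneq i i0.
have : Z i0 i0 ^+ 2 == 1.
  have := orthoP Z; rewrite ZE tr_scalar_mx -scalar_mxM => /matrixP/(_ i0 i0).
  by rewrite !mxE eqxx !mulr1n expr2 => ->.
rewrite sqrf_eq1 => /orP[] /eqP z1; apply/orP; [left|right]; apply/eqP/val_inj;
  rewrite /= ZE z1 //.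
by rewrite raddfN.
Qed.

End SpecialOrthogonalLieAlgebra.

(* The block matrices below have sizes such as 6 + 2 or (2 + 2) + (2 + 2),
   which are convertible to 8. *)
Section Subgroups.
Variable R : realType.

Local Notation "[| X |]" := (@cls R 8 X) (at level 0).
Local Notation I11 := (Ipq 1 1).

Definition classD : PO R 8 := [| ortho_diag4 I11 I11 I11 I11 |].
Definition classE : PO R 8 := [| ortho_diag4 (Jn' 1) (Jn' 1) (Jn' 1) (Jn' 1) |].

Definition F13 : set (PO R 8) :=
  gen [set a | a \in [:: [| Ipq 4 4 |]; [| Jn' 4 |];
                         [| ortho_diag (Ipq 2 2) (Ipq 2 2) |];
                         [| ortho_diag (Jn' 2) (Jn' 2) |]; classD; classE]].

Definition F17 : set (PO R 8) :=
  gen [set a | a \in [:: [| Ipq 4 4 |]; [| Ipq 2 6 |]; [| Ipq 6 2 |];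
                         classD; classE]].

Definition F18 : set (PO R 8) :=
  gen [set a | a \in [:: [| Ipq 4 4 |]; [| Ipq 2 6 |]; [| Ipq 6 2 |]; classD;
                         [| ortho_diag4 (Jn' 1) (Jn' 1) (Jn' 1) (Jn 1) |]]].

Definition F19 : set (PO R 8) :=
  gen [set a | a \in [:: [| Ipq 4 4 |]; [| Ipq 2 6 |]; [| Ipq 6 2 |]; classD;
                         [| ortho_diag4 (Jn' 1) (Jn' 1) (Jn 1) (Jn 1) |]]].

Definition F20 : set (PO R 8) :=
  gen [set a | a \in [:: [| Ipq 4 4 |]; [| Ipq 2 6 |]; [| Ipq 6 2 |];
                         [| ortho_diag4 I11 I11 I11 (Jn 1) |];
                         [| ortho_diag4 (Jn' 1) (Jn' 1) (Jn 1) I11 |]]].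

Definition F22 : set (PO R 8) :=
  @cls R 8 @` [set X : ortho R 8 | is_diag_mx X].

(* W(F) for F a subgroup of O(8)/<-I>, viewed inside G = Aut(so(8)) *)
Definition WG (F : set (PO R 8)) : groupType := W (@AdPO R 8 @` F).

End Subgroups.

(* Main.v *)
From Pilot Require Import Defs.
From HB Require Import structures.
From mathcomp Require Import all_boot all_order all_algebra all_fingroup.
From mathcomp Require Import generic_quotient.
From mathcomp Require Import boolp classical_sets functions cardinality reals.
Import Pilot.Defs.

Set Implicit Arguments.
Unset Strict Implicit.
Unset Printing Implicit Defensive.
Import Order.TTheory GRing.Theory Num.Theory.

(** The group W(F) is the group of automorphisms of F induced by conjugation in
    G = Aut(so(8)), so it is found by bounding these automorphisms from above and
    by exhibiting enough elements of G that normalise F.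

    Conjugation preserves the character [tr_so] of so(8).  Let s_1, ..., s_k
    generate F.  If g normalises F and fixes s_1, ..., s_(j-1), then it sends s_j to
    an element y of F such that w y and w s_j have the same trace for every w in
    the group generated by s_1, ..., s_(j-1).  When every such y is reached by some
    g, the order of W(F) is the product over j of the numbers of such y, by the
    orbit-stabiliser theorem ([stab_chain_card]).  The groups F17, ..., F20 consist
    of classes of signed permutation matrices, and nearly all of the elements g can
    be chosen among such classes; hence traces, membership in F and conjugates are
    computed on tables of signs and columns ([chain_test_card]).  Three points need more.

    - F17 is normalised by an automorphism outside O(8)/<-I>.  For a family of
      matrices M_i with M_i M_j^T + M_j M_i^T = 2 delta_ij, here left
      multiplications by octonion units up to the choice of bases, the half-spin
      map A |-> 1/4 sum_ij A_ij M_i M_j^T is a Lie automorphism ([triality]).  It is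
      an involution, and it exchanges the class of the diagonal matrix with entries
      -1 at k and l with the class of M_k M_l^T ([triality_flip2]).
    - F17 and F20 are normalised by matrices built from (I_(1,1) + J'_1)/sqrt 2,
      which exchanges I_(1,1) and J'_1 by conjugation ([half_conj]).
    - For F19 the traces allow twice too many automorphisms.  The extra ones would
      carry two weight vectors that do not commute to two that do
      ([F19_excluded]).

    Among the diagonal classes, the eight reflections are those of trace 14.  Hence
    the normaliser of F22 permutes them, and permutation matrices induce every
    permutation ([weyl_diagG]).  Let F22+ be the subgroup of F22 generated by
    products of two reflections.  Its weight spaces in so(8) are the lines spanned
    by the E_ij - E_ji, and an automorphism that commutes with F22+ acts on these
    lines by scalars compatible with the bracket, so it is itself a diagonal class
    ([centralizer_evenG_sub]).  It follows that F22 and F22+ have the same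
    normaliser and the same centraliser.  Since [triality] maps F22+ onto F13
    ([evenG_F13]), the groups W(F13) and W(F22) are isomorphic. *)

(** * Conjugation, normalisers and Weyl groups *)

Section Conjugation.
Local Open Scope group_scope.
Local Open Scope classical_set_scope.
Variable G : groupType.
Implicit Types (F K S : set G) (g h x y : G).

(** A left action: [cj (g * h) = cj g \o cj h], unlike [x ^ g]. *)
Definition cj g x := g * x * g^-1.

Lemma cjM g x y : cj g (x * y) = cj g x * cj g y.
Proof. by rewrite /cj !mulgA mulgVK. Qed.

Lemma cj1 g : cj g 1 = 1.
Proof. by rewrite /cj mulg1 mulgV. Qed.

Lemma cjV g x : cj g x^-1 = (cj g x)^-1.
Proof. by rewrite /cj !invgM invgK mulgA. Qed.

Lemma cj_comp g h x : cj (g * h) x = cj g (cj h x).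
Proof. by rewrite /cj invgM !mulgA. Qed.

Lemma cj1l x : cj 1 x = x.
Proof. by rewrite /cj mul1g invg1 mulg1. Qed.

Lemma cjK g : cancel (cj g) (cj g^-1).
Proof. by move=> x; rewrite -cj_comp mulVg cj1l. Qed.

Lemma cjKV g : cancel (cj g^-1) (cj g).
Proof. by move=> x; rewrite -cj_comp mulgV cj1l. Qed.

Lemma cj_fix g x : (cj g x = x) <-> commute g x.
Proof.
rewrite /cj /commute; split=> [{2}<-|->]; first by rewrite mulgVK.
by rewrite mulgK.
Qed.

Lemma cj_eqP g x y : g * x = y * g -> cj g x = y.
Proof. by rewrite /cj => ->; rewrite mulgK. Qed.

Lemma gen_sub S : S `<=` gen S.
Proof. by move=> x Sx K [_]; apply. Qed.

Lemma gen_min S K : group_closed (mem K) -> S `<=` K -> gen S `<=` K.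
Proof. by move=> Kg SK x; apply. Qed.

Lemma gen_one S : gen S 1.
Proof. by move=> K [[]]; rewrite inE. Qed.

Lemma gen_div S x y : gen S x -> gen S y -> gen S (x * y^-1).
Proof.
move=> Sx Sy K KS; have [[_ +] _] := KS.
by move=> /(_ x y); rewrite !inE; apply; [exact: Sx|exact: Sy].
Qed.

Lemma gen_inv S x : gen S x -> gen S x^-1.
Proof. by move=> Sx; rewrite -[x^-1]mul1g; apply: gen_div => //; exact: gen_one. Qed.

Lemma gen_mul S x y : gen S x -> gen S y -> gen S (x * y).
Proof. by move=> Sx Sy; rewrite -[y]invgK; apply: gen_div => //; exact: gen_inv. Qed.

Lemma gen_group S : group_closed (mem (gen S)).
Proof.
by split=> [|x y]; rewrite !inE; [exact: gen_one|exact: gen_div].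
Qed.

Lemma gen_cj S F g : group_closed (mem F) ->
  (forall x, S x -> F (cj g x)) -> forall x, gen S x -> F (cj g x).
Proof.
move=> [F1 FM] SF; refine (@gen_min S [set x | F (cj g x)] _ SF).
move: F1; rewrite inE => F1; split; first by rewrite inE /= cj1.
move=> x y; rewrite !inE /= cjM cjV => Fx Fy.
by have := FM (cj g x) (cj g y); rewrite !inE; apply.
Qed.

Lemma gen_commute S g :
  (forall x, S x -> commute g x) -> forall x, gen S x -> commute g x.
Proof.
move=> Sc; refine (@gen_min S [set x | commute g x] _ Sc); split.
  by rewrite inE; exact: commute1.
by move=> x y; rewrite !inE /= => cx cy; apply: commuteM => //; exact: commuteV.
Qed.

Lemma normalizer_cj F g x : g \in normalizer F -> F x -> F (cj g x).
Proof. by move=> /normalizerP NF Fx; rewrite -NF; exists x. Qed.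

Lemma normalizerV F g : g \in normalizer F -> g^-1 \in normalizer F.
Proof. by move=> Ng; rewrite (group_closedV (normalizer_group F)). Qed.

Lemma normalizerM F g h :
  g \in normalizer F -> h \in normalizer F -> g * h \in normalizer F.
Proof. by move=> Ng Nh; rewrite (group_closedM (normalizer_group F)). Qed.

Lemma normalizer1 F : 1 \in normalizer F.
Proof. by case: (normalizer_group F). Qed.

Lemma normalizer_intro F g :
  (forall x, F x -> F (cj g x)) -> (forall x, F x -> F (cj g^-1 x)) ->
  g \in normalizer F.
Proof.
move=> Fg FgV; apply/normalizerP/seteqP; split=> [_ [x Fx <-]|x Fx].
  exact: Fg.
by exists (cj g^-1 x); [exact: FgV|exact: cjKV].
Qed.

Lemma normalizer_gen S g :
  (forall x, S x -> gen S (cj g x)) -> (forall x, S x -> gen S (cj g^-1 x)) ->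
  g \in normalizer (gen S).
Proof.
by move=> Sg SgV; apply: normalizer_intro; apply: gen_cj => //; exact: gen_group.
Qed.

Lemma normalizer_gen_inv S g : g * g = 1 ->
  (forall x, S x -> gen S (cj g x)) -> g \in normalizer (gen S).
Proof.
move=> g2 Sg; have gV : g^-1 = g by rewrite -[g^-1]mulg1 -g2 mulKg.
by apply: normalizer_gen; rewrite ?gV.
Qed.

Lemma centralizer_cj F g h : h \in normalizer F ->
  g \in centralizer F -> cj h g \in centralizer F.
Proof.
move=> Nh /centralizerP Cg; apply/centralizerP => x Fx.
have /Cg /cj_fix e : F (cj h^-1 x) by apply: normalizer_cj Fx; exact: normalizerV.
apply/cj_fix; have -> : cj h g = h * g * h^-1 by [].
by rewrite !cj_comp e cjKV.
Qed.
(** Used to move a normaliser and a centraliser along a conjugation for which only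
    the correspondence between the two subgroups is known. *)
Lemma normalizer_transport F K h :
  (forall x, F x <-> K (cj h x)) ->
  (forall g, (g \in normalizer F) = (cj h g \in normalizer K)) /\
  (forall g, (g \in centralizer F) = (cj h g \in centralizer K)).
Proof.
move=> FK; have KF x : K x <-> F (cj h^-1 x) by rewrite FK cjKV.
have cjcj g x : cj (cj h g) (cj h x) = cj h (cj g x).
  by rewrite -[cj h g]/(h * g * h^-1) !cj_comp cjK.
have cjcjV g x : cj (cj h g) x = cj h (cj g (cj h^-1 x)).
  by rewrite -cjcj cjKV.
split=> g; apply/idP/idP => gN.
- apply: normalizer_intro => x /KF Fx; rewrite -?cjV cjcjV -FK; apply: normalizer_cj => //.
  exact: normalizerV.
- apply: normalizer_intro => x /FK Kx; apply/FK; rewrite -cjcj ?cjV;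
    apply: normalizer_cj => //.
  exact: normalizerV.
- apply/centralizerP => x /KF /(centralizerP _ _ gN) /cj_fix e.
  by apply/cj_fix; rewrite cjcjV e cjKV.
apply/centralizerP => x /FK /(centralizerP _ _ gN) /cj_fix.
by rewrite cjcj => /(can_inj (cjK h)) /cj_fix.
Qed.

End Conjugation.

Section Images.
Local Open Scope group_scope.
Local Open Scope classical_set_scope.

Lemma image_gen (G H : groupType) (f : G -> H) (S : set G) :
  {morph f : x y / x * y} -> f @` gen S = gen (f @` S).
Proof.
move=> fM; have f1 : f 1 = 1 by apply: (mulgI (f 1)); rewrite -fM !mulg1.
have fV x : f x^-1 = (f x)^-1 by apply: (mulgI (f x)); rewrite -fM !mulgV.
apply/seteqP; split=> [_ [x Sx <-]|].
  have [K1 KM] := gen_group (f @` S).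
  have : gen S `<=` [set x | gen (f @` S) (f x)].
    apply: gen_min => [|y Sy]; last by apply: (@gen_sub _ _ (f y)); exists y.
    split; first by rewrite inE /= f1; exact: gen_one.
    by move=> y z; rewrite !inE /= fM fV; exact: gen_div.
  exact.
apply: gen_min => [|_ [x Sx <-]]; last by exists x => //; exact: gen_sub.
split; first by rewrite inE; exists 1 => //; exact: gen_one.
move=> y z; rewrite !inE => -[y' Sy <-] [z' Sz <-].
by exists (y' * z'^-1); [exact: gen_div | rewrite fM fV].
Qed.

End Images.

Section WeylAction.
Local Open Scope group_scope.
Local Open Scope quotient_scope.
Variables (G : groupType) (F : set G).
Implicit Types (g h x y : G) (w v : W F) (n m : normalizer_group_of F).

Definition weyl_class n : W F := (\pi_(quotg (normalized_centralizer F)) n)%qT.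

Lemma weyl_classM n m : weyl_class (n * m) = weyl_class n * weyl_class m.
Proof. exact: pi_quotgM. Qed.

Lemma weyl_classK w : weyl_class (repr w) = w.
Proof. exact: reprK. Qed.

Lemma weyl_class_eqP n m :
  (val n)^-1 * val m \in centralizer F <-> weyl_class n = weyl_class m.
Proof. by split=> [?|/quotgP //]; apply/quotgP. Qed.

Lemma weyl_class1 : weyl_class 1 = 1.
Proof. by []. Qed.

(** On [F] the chosen representative does not matter, because elements of the same
    coset of the centraliser conjugate [F] in the same way. *)
Definition weyl_act w x := cj (val (repr w)) x.

Lemma weyl_act_class n x : F x -> weyl_act (weyl_class n) x = cj (val n) x.
Proof.
move=> Fx; have /weyl_class_eqP : weyl_class n = weyl_class (repr (weyl_class n)).
  by rewrite weyl_classK.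
move=> /centralizerP /(_ x Fx) /cj_fix; rewrite cj_comp => /(congr1 (cj (val n))).
by rewrite cjKV.
Qed.

Lemma weyl_actM w v x : F x -> weyl_act (w * v) x = weyl_act w (weyl_act v x).
Proof.
move=> Fx; rewrite -[in LHS](weyl_classK w) -[in LHS](weyl_classK v) -weyl_classM.
rewrite weyl_act_class //.
exact: cj_comp.
Qed.

Lemma weyl_act1 x : F x -> weyl_act 1 x = x.
Proof. by move=> Fx; rewrite -weyl_class1 weyl_act_class //; exact: cj1l. Qed.

Lemma weyl_act_faithful w : (forall x, F x -> weyl_act w x = x) -> w = 1.
Proof.
move=> wF; rewrite -[w]weyl_classK -weyl_class1.
apply/esym/weyl_class_eqP/centralizerP => x Fx.
apply/cj_fix; have -> : (val (1 : normalizer_group_of F)) = 1 by [].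
by rewrite invg1 mul1g; exact: wF.
Qed.
End WeylAction.

(** * Counting by a chain of stabilisers *)

Section OrbitCount.
Local Open Scope group_scope.
Variables (G : groupType) (F : set G).
Implicit Types (g x y : G) (s pre base : seq G) (w u : W F).

Definition fixes g s := {in s, forall x, cj g x = x}.

(** Each list of [Y] is the orbit of the next point of [base] under the elements of
    the normaliser that fix the previous points; an element that fixes them all
    has to centralise [F]. *)
Fixpoint stab_chain pre base (Y : seq (seq G)) : Prop :=
  match base, Y with
  | x :: base', ys :: Y' =>
      [/\ F x, uniq ys,
          {in ys, forall y, exists2 g, g \in normalizer F &
                              fixes g pre /\ cj g x = y},
          {in normalizer F, forall g, fixes g pre -> cj g x \in ys} &
          stab_chain (x :: pre) base' Y']
  | [::], [::] => {in normalizer F, forall g, fixes g pre -> g \in centralizer F}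
  | _, _ => False
  end.

Let wfixes w s := {in s, forall x, weyl_act w x = x}.

(** Choose for every [y] in an orbit an element [u y] that maps the point to [y].
    An element of the stabiliser is then a unique product of some [u y] and of an
    element that fixes one more point. *)
Let stab_chain_enum base Y pre : stab_chain pre base Y ->
  (forall x, x \in pre -> F x) ->
  exists E : seq (W F), [/\ uniq E, size E = foldr muln 1%N (map size Y) &
                            forall w, w \in E <-> wfixes w pre].
Proof.
elim: base Y pre => [|x base IH] [|ys Y] pre //=.
  move=> triv Fpre; exists [:: 1]; split=> // w; rewrite inE.
  split=> [/eqP -> y /Fpre Fy|wpre]; first exact: weyl_act1.
  apply/eqP/weyl_act_faithful => y Fy; apply/cj_fix.
  by have /centralizerP : val (repr w) \in centralizer F;
    [exact: triv (valP _) wpre | apply].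
move=> [Fx ys_uniq ys_sub ys_sup chain] Fpre.
have [z|E [E_uniq Esz EP]] := IH _ _ chain.
  by rewrite inE => /predU1P[->//|/Fpre].
have /choice [u uP] : forall y, exists u : W F,
    y \in ys -> wfixes u pre /\ weyl_act u x = y.
  move=> y; have [yY|yN] := boolP (y \in ys); last by exists 1.
  have [g Ng [gpre gx]] := ys_sub _ yY.
  exists (weyl_class (NormalizerElt Ng)) => _; split; last by rewrite weyl_act_class.
  by move=> z zpre; rewrite weyl_act_class ?gpre //; exact: Fpre.
exists [seq u y * e | y <- ys, e <- E]; split.
- apply: allpairs_uniq => // -[? ?] [? ?] /allpairsP[[y e] /= [yY eE [-> ->]]].
  move=> /allpairsP[[y' e'] /= [y'Y e'E [-> ->]]] uE.
  have ex e0 : e0 \in E -> weyl_act e0 x = x by move=> /EP; apply; rewrite mem_head.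
  suff yy' : y = y' by move: uE; rewrite yy' => /mulgI ->.
  move: uE => /(congr1 (fun w => weyl_act w x)); rewrite !weyl_actM // (ex e) // (ex e') //.
  by have [_ ->] := uP _ yY; have [_ ->] := uP _ y'Y.
- by rewrite size_allpairs Esz.
move=> w; split=> [/allpairsP[[y e] /= [yY /EP efix ->]] z zpre|wpre].
  have Fz := Fpre _ zpre; rewrite weyl_actM // efix ?inE ?zpre ?orbT //.
  by have [+ _] := uP _ yY; apply.
have wxY : weyl_act w x \in ys by apply: ys_sup => //; exact: valP.
have [upre ux] := uP _ wxY; set v := u _ in upre ux.
apply/allpairsP; exists (weyl_act w x, v^-1 * w) => /=; split=> //; last by rewrite mulKVg.
have vV z : F z -> weyl_act v z = weyl_act w z -> weyl_act (v^-1 * w) z = z.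
  by move=> Fz vw; rewrite weyl_actM // -vw -weyl_actM // mulVg weyl_act1.
apply/EP => z; rewrite inE => /predU1P[->|zpre]; first exact: vV.
by apply: vV; [exact: Fpre|rewrite upre // wpre].
Qed.

Theorem stab_chain_card base Y : stab_chain [::] base Y ->
  ([set: W F] #= `I_(foldr muln 1%N (map size Y)))%card.
Proof.
move=> /stab_chain_enum [//|E [E_uniq <- EP]].
have inE w : w \in E by apply/EP.
apply/card_set_bijP; exists (index^~ E); split=> [w _|w v _ _ /= wv|i /= iE].
- by rewrite /= index_mem.
- by rewrite -(nth_index 1 (inE w)) wv nth_index.
by exists (nth 1 E i) => //; rewrite index_uniq.
Qed.
End OrbitCount.

(** * Isomorphisms between Weyl groups *)

Section WeylIsom.
Local Open Scope group_scope.
Variables (G : groupType).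
Implicit Types (F K : set G) (h : G).

Definition weyl_map F K h (w : W F) : W K :=
  weyl_class (insubd (1 : normalizer_group_of K) (cj h (val (repr w)))).

Lemma weyl_map_cls F K h :
  (forall g, g \in normalizer F -> cj h g \in normalizer K) ->
  (forall g, g \in centralizer F -> cj h g \in centralizer K) ->
  forall (n : normalizer_group_of F) (m : normalizer_group_of K),
    val m = cj h (val n) -> weyl_map K h (weyl_class n) = weyl_class m.
Proof.
move=> FN FC n m mn; apply/weyl_class_eqP.
have /weyl_class_eqP nC : weyl_class (repr (weyl_class n)) = weyl_class n.
  by rewrite weyl_classK.
rewrite insubdK; last by apply: FN; exact: valP.
by rewrite mn -cjV -cjM; exact: FC.
Qed.

(** W(F) depends only on the normaliser and the centraliser, so groups [F] and [K]
    of different orders may qualify. *)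
Lemma group_isom_weyl F K h :
  (forall g, (g \in normalizer F) = (cj h g \in normalizer K)) ->
  (forall g, (g \in centralizer F) = (cj h g \in centralizer K)) ->
  group_isom (W F) (W K).
Proof.
move=> FN FC.
have FKN g : g \in normalizer F -> cj h g \in normalizer K by rewrite FN.
have KFN g : g \in normalizer K -> cj h^-1 g \in normalizer F by rewrite FN cjKV.
have FKC g : g \in centralizer F -> cj h g \in centralizer K by rewrite FC.
have KFC g : g \in centralizer K -> cj h^-1 g \in centralizer F by rewrite FC cjKV.
pose a (n : normalizer_group_of F) := NormalizerElt (FKN _ (valP n)).
pose b (n : normalizer_group_of K) := NormalizerElt (KFN _ (valP n)).
have aE n : weyl_map K h (weyl_class n) = weyl_class (a n) by apply: weyl_map_cls.
have bE n : weyl_map F h^-1 (weyl_class n) = weyl_class (b n) by apply: weyl_map_cls.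
exists (weyl_map K h) => [w v|].
  rewrite -[w]weyl_classK -[v]weyl_classK -weyl_classM !aE -weyl_classM.
  by congr weyl_class; apply/val_inj/cjM.
exists (weyl_map F h^-1) => w; rewrite -[w]weyl_classK.
  by rewrite aE bE; congr weyl_class; apply: val_inj; rewrite /= cjK.
by rewrite bE aE; congr weyl_class; apply: val_inj; rewrite /= cjKV.
Qed.

Lemma group_isom_sym (H K : groupType) : group_isom H K -> group_isom K H.
Proof.
move=> [f fM [g fK gK]]; exists g; last by exists f.
by move=> x y; rewrite -{1}[x]gK -{1}[y]gK -fM fK.
Qed.
End WeylIsom.

(** * The character of Aut(so(n)) on so(n) *)

Section TraceForm.
Local Open Scope ring_scope.
Variables (R : realType) (n : nat).
Local Notation so := (so R n).
Local Notation aut := (aut_so R n).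
Implicit Types (A B : so) (f g : aut) (i j : 'I_n).

Lemma so_mx_sum (I : Type) (r : seq I) (P : pred I) (F : I -> so) :
  so_mx (\sum_(i <- r | P i) F i) = \sum_(i <- r | P i) so_mx (F i).
Proof. exact: (raddf_sum (\val : so -> 'M[R]_n)). Qed.

Lemma so_mxZ a A : so_mx (a *: A) = a *: so_mx A.
Proof. exact: (linearZ_LR (\val : so -> 'M[R]_n)). Qed.

Lemma so_antisym A i j : A i j = - A j i.
Proof. by have /matrixP/(_ j i) := soP A; rewrite !mxE. Qed.

(** Each basis vector occurs twice, once with each order of its indices, hence the
    factor one half. *)
Lemma so_expand A : A = 2^-1 *: \sum_i \sum_j A i j *: elem_so R i j.
Proof.
apply: val_inj; apply/matrixP => k l.
rewrite -[val _]/(so_mx _) -[val (_ *: _)]/(so_mx _) so_mxZ so_mx_sum mxE.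
rewrite summxE (eq_bigr (fun i => \sum_j (A i j *+ ((k == i) && (l == j))
                          - A i j *+ ((k == j) && (l == i))))).
  under eq_bigr do rewrite sumrB; rewrite sumrB.
  have dsum (i0 j0 : 'I_n) : \sum_i \sum_j A i j *+ ((i0 == i) && (j0 == j)) = A i0 j0.
    rewrite (bigD1 i0) //= (bigD1 j0) //= !eqxx [X in _ + X + _]big1 => [|j /negPf nj].
      rewrite addr0 big1 ?addr0 // => i /negPf ni.
      by rewrite big1 // => j _; rewrite eq_sym ni.
    by rewrite eq_sym nj.
  rewrite dsum (eq_bigr (fun i => \sum_j A i j *+ ((l == i) && (k == j)))) ?dsum.
    rewrite [X in _ = _ * (_ - X)](so_antisym A) opprK -mulr2n -(mulr_natl (A k l)).
    by rewrite mulKf // pnatr_eq0.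
  by move=> i _; apply: eq_bigr => j _; rewrite andbC.
move=> i _; rewrite so_mx_sum summxE; apply: eq_bigr => j _.
by rewrite so_mxZ !mxE mulrBr !mulr_natr.
Qed.

Lemma elem_soE i j k l :
  so_mx (elem_so R i j) k l = ((k == i) && (l == j))%:R - ((k == j) && (l == i))%:R.
Proof. by rewrite !mxE. Qed.

Lemma elem_soN i j : elem_so R i j = - elem_so R j i.
Proof. by apply: val_inj; rewrite /= opprB. Qed.

Lemma autD f (A B : so) : f (A + B) = f A + f B.
Proof. by have [fl _ _] := aut_soP f; have := fl 1 A B; rewrite !scale1r. Qed.

Lemma autZ f a (A : so) : f (a *: A) = a *: f A.
Proof.
have [fl _ _] := aut_soP f; have f0 : f 0 = 0.
  by apply: (addrI (f 0)); rewrite -autD !addr0.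
by have := fl a A 0; rewrite !addr0 f0 addr0.
Qed.

Lemma autL f (A B : so) : f (lie A B) = lie (f A) (f B).
Proof. by have [_ _ ->] := aut_soP f. Qed.

Lemma aut_expand f A : f A = 2^-1 *: \sum_i \sum_j A i j *: f (elem_so R i j).
Proof.
have [fl _ _] := aut_soP f.
pose F : {linear so -> so} := HB.pack (f : so -> so) (GRing.isLinear.Build _ _ _ _ _ fl).
rewrite -[LHS]/(F A) {1}[A]so_expand linearZ; congr (_ *: _); rewrite linear_sum.
by apply: eq_bigr => i _; rewrite linear_sum; apply: eq_bigr => j _; rewrite linearZ.
Qed.

Lemma eq_aut f g : (forall i j, i != j -> f (elem_so R i j) = g (elem_so R i j)) -> f = g.
Proof.
move=> fg; apply/val_inj/funext => A.
rewrite -[LHS]/(f A) -[RHS]/(g A) (aut_expand f) (aut_expand g); congr (_ *: _).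
apply: eq_bigr => i _; apply: eq_bigr => j _; congr (_ *: _).
have [<-|/fg //] := eqVneq i j.
have -> : elem_so R i i = 0 *: elem_so R i i.
  by apply: val_inj => /=; rewrite subrr scaler0.
by rewrite !autZ !scale0r.
Qed.

Lemma Ad1 : Ad (1%g : ortho R n) = 1%g.
Proof. by apply/val_inj/funext => A; exact: conj_so1. Qed.

(** Twice the trace of [f] on [so(n)], read off the basis [E_ij - E_ji], i < j. *)
Definition tr_so f : R := \sum_i \sum_j so_mx (f (elem_so R i j)) i j.

Lemma tr_soC f g : tr_so (f * g)%g = tr_so (g * f)%g.
Proof.
have E h k : tr_so (h * k)%g = \sum_i \sum_j \sum_p \sum_q
    2^-1 * (so_mx (k (elem_so R i j)) p q * so_mx (h (elem_so R p q)) i j).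
  apply: eq_bigr => i _; apply: eq_bigr => j _; rewrite /= aut_expand so_mxZ so_mx_sum.
  rewrite mxE summxE mulr_sumr; apply: eq_bigr => p _.
  rewrite so_mx_sum summxE mulr_sumr; apply: eq_bigr => q _.
  by rewrite so_mxZ mxE.
have swap (H : 'I_n -> 'I_n -> 'I_n -> 'I_n -> R) :
    \sum_i \sum_j \sum_p \sum_q H i j p q = \sum_p \sum_q \sum_i \sum_j H i j p q.
  under eq_bigr do rewrite exchange_big /=; rewrite exchange_big /=.
  apply: eq_bigr => p _; under eq_bigr do rewrite exchange_big /=.
  exact: exchange_big.
rewrite !E swap; do 4![apply: eq_bigr => ? _].
by congr (_ * _); rewrite mulrC.
Qed.

Lemma tr_so_cj f g : tr_so (cj f g) = tr_so g.
Proof. by rewrite /cj tr_soC mulgA mulVg mul1g. Qed.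

(** so(n) is the exterior square of R^n, with character ((tr X)^2 - tr X^2) / 2. *)
Lemma tr_so_Ad (X : ortho R n) :
  tr_so (Ad X) = (\tr X) ^+ 2 - \tr (X *m X).
Proof.
have entry (i j p q : 'I_n) : (X *m delta_mx p q *m X^T) i j = X i p * X j q.
  rewrite -mulmxA mxE (bigD1 p) //= big1 ?addr0 => [|k /negPf np]; last first.
    by rewrite mxE big1 ?mulr0 // => l _; rewrite mxE np mul0r.
  rewrite mxE (bigD1 q) //= big1 ?addr0 => [|l /negPf nq]; last first.
    by rewrite mxE nq andbF mul0r.
  by rewrite !mxE !eqxx mul1r.
rewrite /tr_so expr2 /mxtrace mulr_suml -sumrB; apply: eq_bigr => i _.
rewrite mulr_sumr mxE -sumrB; apply: eq_bigr => j _.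
by rewrite /= mulmxBr mulmxBl mxE [X in _ + X]mxE !entry.
Qed.
End TraceForm.

(** * Signed permutation matrices as tables *)

Section MonomialTables.
Local Open Scope nat_scope.
Implicit Types (m a b : seq (bool * nat)) (p q n : nat).

(** A table lists, row by row, the sign of the nonzero entry (true for -1) and its
    column. *)
Definition row_of m i := nth (false, 0) m i.

Definition wf_tab n m := [&& size m == n, all (fun x => x.2 < n) m & uniq (map snd m)].

Definition mmul a b := [seq (x.1 (+) (row_of b x.2).1, (row_of b x.2).2) | x <- a].
Definition mneg m := [seq (~~ x.1, x.2) | x <- m].
Definition mconst (s : bool) n := mkseq (fun i => (s, i)) n.
Definition mshift p m := [seq (x.1, p + x.2) | x <- m].
(** Tables of the block matrices with blocks [a] and [b] on the diagonal, and on the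
    antidiagonal. *)
Definition mdiag p a b := a ++ mshift p b.
Definition manti p a b := mshift p a ++ b.

(** Equality of the classes modulo -I. *)
Definition eq_pm a b := (a == b) || (a == mneg b).

Definition tab_trace n m : int :=
  foldr (fun i t => (if (row_of m i).2 == i then (-1) ^+ (row_of m i).1 else 0) + t)%R
        0%R (iota 0 n).

Lemma wf_size n m : wf_tab n m -> size m = n.
Proof. by case/and3P => /eqP. Qed.

Lemma wf_lt n m i : wf_tab n m -> i < n -> (row_of m i).2 < n.
Proof. by case/and3P => /eqP <- /(all_nthP (false, 0)) H _ /H. Qed.

Lemma wf_inj n m i j : wf_tab n m -> i < n -> j < n ->
  (row_of m i).2 = (row_of m j).2 -> i = j.
Proof.
case/and3P => /eqP sz _ /(uniqP 0) H iN jN eij.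
by apply: H; rewrite ?inE ?size_map ?sz // !(nth_map (false, 0)) ?sz.
Qed.

Lemma wf_mmul n a b : wf_tab n a -> wf_tab n b -> wf_tab n (mmul a b).
Proof.
move=> wa wb; have sa := wf_size wa; apply/and3P; split.
- by rewrite size_map sa.
- apply/allP => _ /mapP[x xa ->] /=; apply: wf_lt wb _.
  by case/and3P: wa => _ /allP/(_ _ xa).
rewrite -map_comp (map_comp (fun k => (row_of b k).2) snd) map_inj_in_uniq.
  by case/and3P: wa.
move=> _ _ /mapP[x xa ->] /mapP[y ya ->] /=; case/and3P: wa => _ /allP wa _.
by apply: (wf_inj wb); apply: wa.
Qed.

Lemma wf_mneg n m : wf_tab n m -> wf_tab n (mneg m).
Proof. by rewrite /wf_tab size_map all_map -map_comp. Qed.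

Lemma row_of_mmul n a b i : wf_tab n a -> i < n ->
  row_of (mmul a b) i = ((row_of a i).1 (+) (row_of b (row_of a i).2).1,
                         (row_of b (row_of a i).2).2).
Proof. by move=> /wf_size sa iN; rewrite /row_of (nth_map (false, 0)) ?sa. Qed.

Lemma wf_mconst s n : wf_tab n (mconst s n).
Proof.
rewrite /wf_tab size_mkseq eqxx /mconst /mkseq all_map -map_comp map_id iota_uniq andbT.
by apply/allP => i; rewrite mem_iota.
Qed.

Lemma row_of_mconst s n i : i < n -> row_of (mconst s n) i = (s, i).
Proof. by move=> iN; rewrite /row_of nth_mkseq. Qed.

End MonomialTables.

Section MonomialMatrices.
Local Open Scope ring_scope.
Variable R : realType.
Implicit Types (m a b : seq (bool * nat)) (p q n : nat).

Definition mono_mx n m : 'M[R]_n :=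
  \matrix_(i, j) ((-1) ^+ (row_of m i).1 *+ ((row_of m i).2 == j)).

Lemma mono_mx_mull n p m (A : 'M[R]_(n, p)) (i : 'I_n) (k : 'I_n) (j : 'I_p) :
  (row_of m i).2 = k -> (mono_mx n m *m A) i j = (-1) ^+ (row_of m i).1 * A k j.
Proof.
move=> ik; rewrite mxE (bigD1 k) //= mxE ik eqxx big1 ?addr0 // => l /negPf lk.
by rewrite mxE ik eq_sym -val_eqE /= in lk *; rewrite lk mul0r.
Qed.

Lemma mono_mx_conj n m (A : 'M[R]_n) (i j k l : 'I_n) (s t : bool) :
  row_of m i = (s, k : nat) -> row_of m j = (t, l : nat) ->
  (mono_mx n m *m A *m (mono_mx n m)^T) i j = (-1) ^+ s * (-1) ^+ t * A k l.
Proof.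
move=> ri rj; rewrite -mulmxA (@mono_mx_mull _ _ _ _ i k j) ?ri //= -mulrA.
congr (_ * _); rewrite -[A *m _]trmxK mxE trmx_mul trmxK.
by rewrite (@mono_mx_mull _ _ _ _ j l k) ?rj // mxE.
Qed.

Lemma mono_mxM n a b : wf_tab n a -> mono_mx n (mmul a b) = mono_mx n a *m mono_mx n b.
Proof.
move=> wa; apply/matrixP => i j.
rewrite (mono_mx_mull _ _ (k := Ordinal (wf_lt wa (ltn_ord i)))) // !mxE /=.
by rewrite (row_of_mmul _ wa) //= signr_addb mulrnAr.
Qed.

Lemma mono_mx_trE n m : wf_tab n m -> mono_mx n m *m (mono_mx n m)^T == 1%:M.
Proof.
move=> wm; apply/eqP/matrixP => i j.
rewrite (mono_mx_mull _ _ (k := Ordinal (wf_lt wm (ltn_ord i)))) // !mxE /=.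
rewrite mulrnAr -signr_addb.
have [<-|ij] := eqVneq i j; first by rewrite eqxx addbb.
case: eqP => // /(wf_inj wm (ltn_ord _) (ltn_ord _)) /val_inj ji.
by rewrite ji eqxx in ij.
Qed.

Definition orth_tab n m : ortho R n := insubd (1%g : ortho R n) (mono_mx n m).

Lemma val_orth_tab n m : wf_tab n m -> ortho_mx (orth_tab n m) = mono_mx n m.
Proof. by move=> wm; rewrite -[LHS]/(val _) insubdK //; exact: mono_mx_trE. Qed.

Lemma orth_tabM n a b : wf_tab n a -> wf_tab n b ->
  orth_tab n (mmul a b) = (orth_tab n a * orth_tab n b)%g.
Proof.
move=> wa wb; apply: val_inj => /=.
by rewrite -![val _]/(ortho_mx _) !val_orth_tab ?wf_mmul // mono_mxM.
Qed.

Lemma mono_mx_mneg n m : wf_tab n m -> mono_mx n (mneg m) = - mono_mx n m.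
Proof.
move=> /wf_size sm; apply/matrixP => i j; rewrite !mxE /row_of (nth_map (false, 0%N)) ?sm //.
by rewrite /= signrN mulNrn.
Qed.

Lemma orth_tab_mneg n m : wf_tab n m -> orth_tab n (mneg m) = ortho_opp (orth_tab n m).
Proof.
move=> wm; apply: val_inj => /=.
by rewrite -![val _]/(ortho_mx _) !val_orth_tab ?wf_mneg // mono_mx_mneg.
Qed.

Lemma mono_mx_const n s : mono_mx n (mconst s n) = (-1) ^+ s *: 1%:M.
Proof.
apply/matrixP => i j; rewrite !mxE row_of_mconst //= -val_eqE /=.
by case: eqP; rewrite ?mulr1 ?mulr0.
Qed.

Lemma orth_tab1 n : orth_tab n (mconst false n) = 1%g.
Proof.
apply: val_inj => /=; rewrite -[LHS]/(ortho_mx _) val_orth_tab ?wf_mconst //.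
by rewrite mono_mx_const expr0 scale1r.
Qed.

Lemma mono_mx_diag p q a b : wf_tab p a -> wf_tab q b ->
  mono_mx (p + q) (mdiag p a b) = block_mx (mono_mx p a) 0 0 (mono_mx q b).
Proof.
move=> wa wb; have sa := wf_size wa; have sb := wf_size wb.
apply/matrixP => i j; rewrite [LHS]mxE /row_of nth_cat sa.
case: (split_ordP i) => i' -> /=; case: (split_ordP j) => j' ->.
- by rewrite ?ltn_ord block_mxEul mxE.
- have := wf_lt wa (ltn_ord i'); rewrite ?ltn_ord block_mxEur mxE /row_of => ltp.
  by rewrite ltn_eqF // (leq_trans ltp) // leq_addr.
- rewrite /= addKn (nth_map (false, 0%N)) ?sb // block_mxEdl mxE /=.
  by rewrite gtn_eqF // (leq_trans (ltn_ord _)) // leq_addr.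
by rewrite /= addKn (nth_map (false, 0%N)) ?sb // block_mxEdr mxE /= eqn_add2l.
Qed.

Lemma mono_mx_anti p a b : wf_tab p a -> wf_tab p b ->
  mono_mx (p + p) (manti p a b) = block_mx 0 (mono_mx p a) (mono_mx p b) 0.
Proof.
move=> wa wb; have sa := wf_size wa; have sb := wf_size wb.
apply/matrixP => i j; rewrite [LHS]mxE /row_of nth_cat size_map sa.
case: (split_ordP i) => i' -> /=; case: (split_ordP j) => j' ->.
- rewrite ?ltn_ord (nth_map (false, 0%N)) ?sa // block_mxEul mxE /=.
  by rewrite gtn_eqF // (leq_trans (ltn_ord _)) // leq_addr.
- by rewrite ?ltn_ord (nth_map (false, 0%N)) ?sa // block_mxEur mxE /= eqn_add2l.
- by rewrite /= addKn block_mxEdl mxE.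
have := wf_lt wb (ltn_ord i'); rewrite /= addKn block_mxEdr mxE /row_of.
by move=> ltp; rewrite ltn_eqF // (leq_trans ltp) // leq_addr.
Qed.

Lemma wf_mdiag p q a b : wf_tab p a -> wf_tab q b -> wf_tab (p + q) (mdiag p a b).
Proof.
move=> /and3P[/eqP sa la ua] /and3P[/eqP sb lb ub]; apply/and3P; split.
- by rewrite size_cat size_map sa sb.
- rewrite all_cat all_map; apply/andP; split.
    by apply: sub_all la => x /leq_trans; apply; rewrite leq_addr.
  by apply: sub_all lb => x /=; rewrite ltn_add2l.
rewrite map_cat cat_uniq ua -map_comp /=; apply/andP; split.
  apply/hasPn => _ /mapP[x xb ->]; apply/mapP => -[y ya] /= e.
  by have := allP la _ ya; rewrite -e ltnNge leq_addr.
by rewrite (map_comp (addn p) snd) map_inj_uniq //; exact: addnI.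
Qed.

Lemma orth_tab_diag p q a b : wf_tab p a -> wf_tab q b ->
  ortho_diag (orth_tab p a) (orth_tab q b) = orth_tab (p + q) (mdiag p a b).
Proof.
move=> wa wb; apply: val_inj; rewrite /= -[RHS]/(ortho_mx _) !val_orth_tab ?wf_mdiag //.
by rewrite mono_mx_diag.
Qed.

Lemma orth_tab_eq n m (X : ortho R n) :
  wf_tab n m -> ortho_mx X = mono_mx n m -> X = orth_tab n m.
Proof. by move=> wm Xm; apply: val_inj; rewrite -![val _]/(ortho_mx _) val_orth_tab. Qed.

Lemma orth_tab_Ipq p q :
  Ipq p q = orth_tab (p + q) (mdiag p (mconst true p) (mconst false q)).
Proof.
apply: orth_tab_eq; first by rewrite wf_mdiag ?wf_mconst.
by rewrite mono_mx_diag ?wf_mconst // !mono_mx_const expr0 scale1r expr1 scaleN1r.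
Qed.

Lemma wf_manti p a b : wf_tab p a -> wf_tab p b -> wf_tab (p + p) (manti p a b).
Proof.
move=> wa wb; have := wf_mdiag wb wa; rewrite /wf_tab.
have E : perm_eq (manti p a b) (mdiag p b a) by rewrite perm_catC.
by rewrite (perm_size E) (perm_all _ E) (perm_uniq (perm_map snd E)).
Qed.

Lemma orth_tab_Jn p : Jn p = orth_tab (p + p) (manti p (mconst false p) (mconst true p)).
Proof.
apply: orth_tab_eq; first by rewrite wf_manti ?wf_mconst.
by rewrite mono_mx_anti ?wf_mconst // !mono_mx_const expr0 scale1r expr1 scaleN1r.
Qed.

Lemma orth_tab_Jn' p : Jn' p = orth_tab (p + p) (manti p (mconst false p) (mconst false p)).
Proof.
apply: orth_tab_eq; first by rewrite wf_manti ?wf_mconst.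
by rewrite mono_mx_anti ?wf_mconst // !mono_mx_const expr0 scale1r.
Qed.

Lemma tr_mono_mx n m : \tr (mono_mx n m) = (tab_trace n m)%:~R.
Proof.
rewrite /mxtrace /tab_trace.
pose f i : R := (-1) ^+ (row_of m i).1 *+ ((row_of m i).2 == i).
rewrite (eq_bigr (fun i : 'I_n => f i)) => [|i _]; last by rewrite mxE.
rewrite -(big_mkord xpredT f) /index_iota subn0.
elim: (iota 0 n) => [|i s IH]; first by rewrite big_nil.
rewrite big_cons IH /= intrD /f; congr (_ + _).
by case: eqP => _; rewrite ?rmorph_sign.
Qed.
End MonomialMatrices.

Section ProjectiveTables.
Local Open Scope ring_scope.
Variable R : realType.
Implicit Types (m a b : seq (bool * nat)).

Definition Ad_tab m : aut_so R 8 := Ad (orth_tab R 8 m).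

Lemma Ad_tabM a b : wf_tab 8 a -> wf_tab 8 b -> Ad_tab (mmul a b) = (Ad_tab a * Ad_tab b)%g.
Proof. by move=> wa wb; rewrite /Ad_tab orth_tabM // AdM. Qed.

Lemma Ad_tab1 : Ad_tab (mconst false 8) = 1%g.
Proof. by rewrite /Ad_tab orth_tab1 Ad1. Qed.

Lemma Ad_tab_eq_pm a b : wf_tab 8 b -> eq_pm a b -> Ad_tab a = Ad_tab b.
Proof. by move=> wb /orP[]/eqP-> //; rewrite /Ad_tab orth_tab_mneg // Ad_opp. Qed.

Lemma mono_mx_inj n a b : wf_tab n a -> wf_tab n b -> mono_mx R n a = mono_mx R n b -> a = b.
Proof.
move=> wa wb ab; apply: (@eq_from_nth _ (false, 0%N)).
  by rewrite (wf_size wa) (wf_size wb).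
move=> i; rewrite (wf_size wa) => iN.
have /matrixP/(_ (Ordinal iN) (Ordinal (wf_lt wa iN))) := ab.
rewrite !mxE /= eqxx mulr1n -![nth _ _ i]/(row_of _ i).
case: (row_of a i) (row_of b i) => s k [t l] /=; case: eqP => [->|_].
  by rewrite mulr1n => /signr_inj ->.
by move/eqP; rewrite signr_eq0.
Qed.

Lemma Ad_tab_inj a b : wf_tab 8 a -> wf_tab 8 b -> Ad_tab a = Ad_tab b -> eq_pm a b.
Proof.
move=> wa wb; rewrite /Ad_tab -!AdPO_cls => /(AdPO_inj (isT : (2 < 8)%N)) /quotgP.
rewrite -[normal_pred _]/(@gen_m1 R 8) gen_m1E /eq_pm => /orP[] /eqP ab.
  have /(congr1 (@ortho_mx R 8)) : orth_tab R 8 a = orth_tab R 8 b.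
    by apply/esym; rewrite -[orth_tab R 8 b](mulKVg (orth_tab R 8 a)) ab mulg1.
  by rewrite !val_orth_tab // => /(mono_mx_inj wa wb) ->; rewrite eqxx.
have /(congr1 (@ortho_mx R 8)) : orth_tab R 8 b = ortho_opp (orth_tab R 8 a).
  rewrite -[LHS](mulKVg (orth_tab R 8 a)) ab; apply: val_inj => /=.
  by rewrite mulmxN mulmx1.
rewrite -orth_tab_mneg // !val_orth_tab ?wf_mneg // => /(mono_mx_inj wb (wf_mneg wa)) ->.
apply/orP; right; apply/eqP; rewrite /mneg -map_comp.
by rewrite -[LHS]map_id; apply: eq_map => -[s k] /=; rewrite negbK.
Qed.

(** Integer value of [tr_so], by the formula for the exterior square. *)
Definition tab_char m : int := tab_trace 8 m * tab_trace 8 m - tab_trace 8 (mmul m m).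

Lemma tr_so_Ad_tab m : wf_tab 8 m -> tr_so (Ad_tab m) = (tab_char m)%:~R.
Proof.
by move=> wm; rewrite tr_so_Ad val_orth_tab // -mono_mxM // !tr_mono_mx rmorphB rmorphM.
Qed.

Lemma Ad_tab_entry m (A : so R 8) (i j k l : 'I_8) (s t : bool) : wf_tab 8 m ->
  row_of m i = (s, k : nat) -> row_of m j = (t, l : nat) ->
  so_mx (Ad_tab m A) i j = (-1) ^+ s * (-1) ^+ t * A k l.
Proof. by move=> wm ri rj; rewrite /= val_orth_tab // (mono_mx_conj _ ri rj). Qed.

Lemma cj_Ad_tab a b c : wf_tab 8 a -> wf_tab 8 b -> wf_tab 8 c ->
  eq_pm (mmul a b) (mmul c a) -> cj (Ad_tab a) (Ad_tab b) = Ad_tab c.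
Proof.
move=> wa wb wc abc; apply: cj_eqP; rewrite -!Ad_tabM //; apply: Ad_tab_eq_pm => //.
exact: wf_mmul.
Qed.
End ProjectiveTables.

(** * Deciding a chain of stabilisers on tables *)

Section StabiliserTests.
Local Open Scope group_scope.
Local Open Scope classical_set_scope.
Local Notation table := (seq (bool * nat)).
Local Notation one := (mconst false 8).
Implicit Types (m a b g : table) (s E pre gens : seq table).

Fixpoint tab_span s : seq table :=
  if s is g :: s' then let E := tab_span s' in E ++ [seq mmul g e | e <- E]
  else [:: one].

(** Elements of order 4 occur: with their squares listed, products of subsets
    already exhaust the group that [pre] generates when it is commutative. *)
Definition with_squares pre :=
  pre ++ [seq m <- [seq mmul x x | x <- pre] | ~~ eq_pm m one].

(** One step of the chain.  The list [starts] contains the point and its images under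
    elements of the normaliser that are not given by tables,
    [excluded] contains elements that have the right traces but are not images of
    the point, and [movers] contains tables that carry [starts] to the whole orbit. *)
Record level := Level {
  point : table; starts : seq table; excluded : seq table; movers : seq table
}.

Definition same_traces pre a b :=
  all (fun w => tab_char (mmul w a) == tab_char (mmul w b)) (tab_span (with_squares pre)).

Definition candidates E pre l :=
  [seq y <- E | same_traces pre y (point l) & ~~ has (eq_pm y) (excluded l)].

Definition normalises gens E a :=
  all (fun g => has (fun e => eq_pm (mmul a g) (mmul e a)) E
             && has (fun e => eq_pm (mmul g a) (mmul a e)) E) gens.

Definition moves gens E pre y s a :=
  [&& wf_tab 8 a, has (fun x => eq_pm (mmul a x) (mmul y a)) s,
      all (fun p => eq_pm (mmul a p) (mmul p a)) pre & normalises gens E a].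

Definition level_test gens E pre l :=
  all (fun y => has (moves gens E pre y (starts l)) (movers l)) (candidates E pre l).

Fixpoint chain_test gens E pre ls :=
  if ls is l :: ls' then
    [&& has (eq_pm (point l)) E, wf_tab 8 (point l), all (wf_tab 8) (starts l),
        all (wf_tab 8) (excluded l), level_test gens E pre l &
        chain_test gens E (point l :: pre) ls']
  else all (fun g => has (eq_pm g) (with_squares pre)) gens.

Definition group_test E :=
  [&& pairwise (fun a b => ~~ eq_pm a b) E,
      all (fun a => all (fun b => has (eq_pm (mmul a b)) E) E) E &
      all (fun a => has (fun b => eq_pm (mmul b a) one) E) E].

Fixpoint orbit_sizes E pre ls :=
  if ls is l :: ls' then size (candidates E pre l) :: orbit_sizes E (point l :: pre) ls'
  else [::].

Variable R : realType.
Local Notation Ad_tab := (Ad_tab R).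
Local Notation aut := (aut_so R 8).

Definition tab_group gens : set aut := gen [set x | x \in map Ad_tab gens].

Definition fixing gens pre (g : aut) : Prop :=
  g \in normalizer (tab_group gens) /\ fixes g (map Ad_tab pre).

(** What [chain_test] leaves to be proved about [starts] and [excluded]. *)
Fixpoint specials gens pre ls : Prop :=
  if ls is l :: ls' then
    [/\ {in starts l, forall x,
           exists2 h, fixing gens pre h & cj h (Ad_tab (point l)) = Ad_tab x},
        {in excluded l, forall x, forall h, fixing gens pre h ->
           cj h (Ad_tab (point l)) <> Ad_tab x} &
        specials gens (point l :: pre) ls']
  else True.

Variable gens : seq table.
Hypothesis wf_gens : all (wf_tab 8) gens.

Lemma wf_span s : all (wf_tab 8) s -> all (wf_tab 8) (tab_span s).
Proof.
elim: s => [_|g s IH /andP[wg /IH ws]] /=; first by [].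
rewrite all_cat ws all_map; apply/allP => e es /=.
by apply: wf_mmul => //; exact: (allP ws).
Qed.

Lemma wf_squares pre : all (wf_tab 8) pre -> all (wf_tab 8) (with_squares pre).
Proof.
move=> wp; rewrite all_cat wp; apply/allP => m; rewrite mem_filter.
by case/andP => _ /mapP[x /(allP wp) wx ->]; exact: wf_mmul.
Qed.

Let E := tab_span gens.
Let wE : all (wf_tab 8) E. Proof. exact: wf_span. Qed.

Hypothesis E_group : group_test E.

Lemma one_in_span s : one \in tab_span s.
Proof. by elim: s => //= g s IH; rewrite mem_cat IH. Qed.

Lemma gens_in_span s g : all (wf_tab 8) s -> g \in s -> g \in tab_span s.
Proof.
have mmul1 a : wf_tab 8 a -> mmul a one = a.
  move=> wa; apply: (@eq_from_nth _ (false, 0%N)); first by rewrite size_map.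
  move=> i; rewrite size_map => ia; rewrite (wf_size wa) in ia.
  rewrite -/(row_of _ _) (row_of_mmul _ wa) //.
  rewrite row_of_mconst ?(wf_lt wa) // addbF -/(row_of a i).
  by case: (row_of a i).
elim: s => //= h s IH /andP[wh ws]; rewrite inE mem_cat => /predU1P[->|/(IH ws)->//].
apply/orP; right; apply/mapP; exists one; first exact: one_in_span.
by rewrite mmul1.
Qed.

Lemma tab_span_gen s m : all (wf_tab 8) s -> m \in tab_span s ->
  gen [set x | x \in map Ad_tab s] (Ad_tab m).
Proof.
move=> ws; suff H s' : {subset s' <= s} ->
    {in tab_span s', forall m, gen [set x | x \in map Ad_tab s] (Ad_tab m)} by
    exact: (H s (fun=> id) m).
elim: s' => [_ m'|h s' IH sub m' /=]; rewrite ?inE.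
  by move=> /eqP ->; rewrite Ad_tab1; exact: gen_one.
have sub' : {subset s' <= s} by move=> x xs'; apply: sub; rewrite inE xs' orbT.
have hs : h \in s by apply: sub; rewrite mem_head.
have ws' : all (wf_tab 8) (tab_span s') by apply/wf_span/allP => x /sub' /(allP ws).
rewrite mem_cat => /orP[/(IH sub') //|/mapP[e es' ->]].
rewrite Ad_tabM ?(allP ws _ hs) ?(allP ws' _ es') //; apply: gen_mul; last exact: IH.
by apply: (@gen_sub _ _ (Ad_tab h)); exact: map_f.
Qed.

Lemma tab_groupP x : tab_group gens x <-> exists2 m, m \in E & x = Ad_tab m.
Proof.
split=> [|[m mE ->]]; last exact: tab_span_gen.
case/and3P: E_group => _ /allP EM /allP EV.
pose K := [set x : aut | exists2 m, m \in E & x = Ad_tab m].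
have KM a b : a \in E -> b \in E -> exists2 c, c \in E & Ad_tab a * Ad_tab b = Ad_tab c.
  move=> aE bE; have /hasP[c cE abc] := allP (EM _ aE) _ bE; exists c => //.
  by rewrite -Ad_tabM ?(allP wE) //; apply: Ad_tab_eq_pm => //; exact: (allP wE).
apply: (@gen_min _ _ K); first split; rewrite ?inE.
- by exists one; [exact: one_in_span | rewrite Ad_tab1].
- move=> a b; rewrite !inE => -[m mE ->] [m' m'E ->].
  have /hasP[v vE vm] := EV _ m'E.
  suff -> : (Ad_tab m')^-1 = Ad_tab v by exact: KM.
  apply: (mulIg (Ad_tab m')); rewrite mulVg -Ad_tabM ?(allP wE) // -Ad_tab1; apply/esym.
  by apply: Ad_tab_eq_pm vm; exact: wf_mconst.
by move=> _ /mapP[g gS ->]; exists g => //; exact: gens_in_span.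
Qed.

Lemma normalises_in a :
  wf_tab 8 a -> normalises gens E a -> Ad_tab a \in normalizer (tab_group gens).
Proof.
move=> wa /allP aN; apply: normalizer_gen => _ /mapP[g gg ->].
  have /andP[/hasP[e eE age] _] := aN _ gg.
  rewrite (cj_Ad_tab R wa (allP wf_gens _ gg) (allP wE _ eE) age).
  by apply/tab_groupP; exists e.
have /andP[_ /hasP[e eE gae]] := aN _ gg.
have -> : cj (Ad_tab a)^-1 (Ad_tab g) = Ad_tab e.
  apply: (can_inj (cjK (Ad_tab a))); rewrite cjKV; apply/esym/cj_eqP.
  have we := allP wE _ eE; have wg := allP wf_gens _ gg.
  by apply/esym; rewrite -!Ad_tabM //; apply: Ad_tab_eq_pm gae; exact: wf_mmul.
by apply/tab_groupP; exists e.
Qed.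

Lemma fixes_span h pre m : all (wf_tab 8) pre -> fixes h (map Ad_tab pre) ->
  m \in tab_span (with_squares pre) -> cj h (Ad_tab m) = Ad_tab m.
Proof.
move=> wp hp.
have hsq x : x \in with_squares pre -> wf_tab 8 x /\ cj h (Ad_tab x) = Ad_tab x.
  move=> xs; split; first exact: (allP (wf_squares wp)).
  move: xs; rewrite mem_cat mem_filter => /orP[xp|/andP[_ /mapP[y yp ->]]].
    by apply: hp; exact: map_f.
  by rewrite (Ad_tabM _ (allP wp _ yp) (allP wp _ yp)) cjM hp ?map_f.
elim: (with_squares pre) hsq m => [_ m|g s IH sub m /=].
  by rewrite inE => /eqP ->; rewrite Ad_tab1 cj1.
have sub' x : x \in s -> wf_tab 8 x /\ cj h (Ad_tab x) = Ad_tab x.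
  by move=> xs; apply: sub; rewrite inE xs orbT.
have ws : all (wf_tab 8) (tab_span s) by apply/wf_span/allP => x /sub' [].
have [wg hg] := sub g (mem_head _ _).
rewrite mem_cat => /orP[/(IH sub') //|/mapP[e es ->]].
by rewrite (Ad_tabM _ wg (allP ws _ es)) cjM hg IH.
Qed.

(** The upper bound: [h] fixes [w], so it conjugates [w * a] to [w * b], and these
    have the same trace. *)
Lemma traces_ok h pre a b : all (wf_tab 8) pre -> wf_tab 8 a -> wf_tab 8 b ->
  fixes h (map Ad_tab pre) -> cj h (Ad_tab a) = Ad_tab b -> same_traces pre b a.
Proof.
move=> wp wa wb hp hab; apply/allP => w ws.
have ww : wf_tab 8 w by exact: (allP (wf_span (wf_squares wp))).
apply/eqP; apply: (@intr_inj R); rewrite -!tr_so_Ad_tab ?wf_mmul // !Ad_tabM //.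
by rewrite -(tr_so_cj h (_ * Ad_tab a)) cjM hab (fixes_span wp hp ws).
Qed.

Lemma chain_test_stab pre ls : all (wf_tab 8) pre -> chain_test gens E pre ls ->
  specials gens pre ls ->
  exists Y, map size Y = orbit_sizes E pre ls /\
     stab_chain (tab_group gens) (map Ad_tab pre) [seq Ad_tab (point l) | l <- ls] Y.
Proof.
elim: ls pre => [|l ls IH] pre wp /=.
  move=> /allP gs _; exists [::]; split=> // h Nh hp; apply/centralizerP.
  apply: gen_commute => _ /mapP[g gg ->]; apply/cj_fix.
  have /hasP[m ms gm_m] := gs _ gg.
  rewrite (Ad_tab_eq_pm R (allP (wf_squares wp) _ ms) gm_m).
  by apply: (fixes_span wp hp); apply: gens_in_span => //; exact: wf_squares.
case/and5P => pE wpt wst wex /andP[lt ct] [st ex sp].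
have [|Y [YE Ych]] := IH (point l :: pre) _ ct sp; first by rewrite /= wpt.
have Fpt : tab_group gens (Ad_tab (point l)).
  case/hasP: pE => e eE pe; rewrite (Ad_tab_eq_pm R (allP wE _ eE) pe).
  by apply/tab_groupP; exists e.
have wC y : y \in candidates E pre l -> wf_tab 8 y.
  by rewrite mem_filter => /andP[_ /(allP wE)].
exists (map Ad_tab (candidates E pre l) :: Y); split; first by rewrite /= size_map YE.
split=> //.
- rewrite uniq_pairwise pairwise_map; case/and3P: E_group => Epw _ _.
  apply: (sub_in_pairwise (P := wf_tab 8) _ _ (pairwise_filter _ Epw)); last exact/allP/wC.
  move=> a b wa wb; apply: contraNneq => /=; exact: Ad_tab_inj.
- move=> _ /mapP[y yC ->]; have /hasP[a _] := allP lt _ yC.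
  case/and4P => wa /hasP[x xs axy] /allP ap aN.
  have [h [Nh hp] hx] := st _ xs.
  have wx := allP wst _ xs; have wy := wC _ yC.
  exists (Ad_tab a * h); first by apply: normalizerM => //; exact: normalises_in.
  split; last by rewrite cj_comp hx (cj_Ad_tab _ _ _ _ axy).
  move=> _ /mapP[p pp ->]; have wpp := allP wp _ pp.
  by rewrite cj_comp hp ?map_f // (cj_Ad_tab _ _ _ _ (ap _ pp)).
- move=> h Nh hp; have /tab_groupP[m mE hm] := normalizer_cj Nh Fpt.
  rewrite hm map_f // mem_filter mE andbT (traces_ok wp wpt (allP wE _ mE) hp hm) /=.
  apply/hasPn => x xex; apply/negP => mx.
  apply: (ex _ xex h); first by split.
  by rewrite hm; apply: Ad_tab_eq_pm mx; exact: (allP wex).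
Qed.

Theorem chain_test_card ls : chain_test gens E [::] ls -> specials gens [::] ls ->
  ([set: W (tab_group gens)] #= `I_(foldr muln 1%N (orbit_sizes E [::] ls)))%card.
Proof.
by move=> ct sp; have [//|Y [<- /stab_chain_card]] := chain_test_stab _ ct sp.
Qed.
End StabiliserTests.

(** * The half-spin representation *)

Section CliffordFamily.
Local Open Scope ring_scope.
Variables (R : realType) (n m : nat) (M : 'I_n -> 'M[R]_m).
Hypothesis MMT : forall i j, M i *m (M j)^T = (2 *+ (i == j))%:M - M j *m (M i)^T.
Hypothesis MTM : forall i j, (M i)^T *m M j = (2 *+ (i == j))%:M - (M j)^T *m M i.
Implicit Types (A B : 'M[R]_n) (i j k l : 'I_n).

(** For distinct [i], [j] these are twice the images of the rotation generators under
    the half-spin representation; on the diagonal they are the identity. *)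
Definition biv i j := M i *m (M j)^T.
Definition bivsum A := \sum_i \sum_j A i j *: biv i j.

(** Carry [M i *m (M j)^T] past [M k *m (M l)^T] by four exchanges; each exchange
    changes the sign and, when two indices agree, leaves a term behind. *)
Lemma biv_comm i j k l : biv i j *m biv k l - biv k l *m biv i j =
  (2 *+ (j == k)) *: biv i l - (2 *+ (i == k)) *: biv j l
  + ((2 *+ (j == l)) *: biv k i - (2 *+ (i == l)) *: biv k j).
Proof.
have step1 : biv i j *m biv k l =
    (2 *+ (j == k)) *: biv i l - (2 *+ (i == k)) *: biv j l + biv k i *m biv j l.
  rewrite {1}/biv mulmxA -(mulmxA (M i)) MTM mulmxBr mulmxBl mul_mx_scalar -scalemxAl.
  rewrite -addrA; congr (_ + _); rewrite mulmxA -mulmxA MMT mulmxBl mul_scalar_mx.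
  by rewrite opprB addrC.
have step2 : biv k i *m biv j l =
    (2 *+ (j == l)) *: biv k i - (2 *+ (i == l)) *: biv k j + biv k l *m biv i j.
  rewrite {2}/biv MMT mulmxBr mul_mx_scalar -addrA; congr (_ + _).
  rewrite {1}/biv mulmxA -(mulmxA (M k)) MTM mulmxBr mulmxBl mul_mx_scalar -scalemxAl.
  by rewrite opprB addrC -!mulmxA.
by rewrite step1 step2 addrA addrK.
Qed.

Lemma bivsumD A B : bivsum (A + B) = bivsum A + bivsum B.
Proof.
rewrite -big_split; apply: eq_bigr => i _; rewrite -big_split; apply: eq_bigr => j _.
by rewrite mxE scalerDl.
Qed.

Lemma bivsumZ a A : bivsum (a *: A) = a *: bivsum A.
Proof.
rewrite scaler_sumr; apply: eq_bigr => i _; rewrite scaler_sumr; apply: eq_bigr => j _.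
by rewrite mxE scalerA.
Qed.

Lemma bivsumN A : bivsum (- A) = - bivsum A.
Proof. by rewrite -scaleN1r bivsumZ scaleN1r. Qed.

Lemma bivsum_tr A : (bivsum A)^T = bivsum A^T.
Proof.
rewrite /bivsum exchange_big raddf_sum; apply: eq_bigr => i _.
rewrite raddf_sum; apply: eq_bigr => j _.
apply/matrixP => p q; rewrite !mxE; congr (_ * _).
by apply: eq_bigr => r _; rewrite !mxE mulrC.
Qed.

Let big4 (H : 'I_n -> 'I_n -> 'I_n -> 'I_n -> 'M[R]_m) :=
  \sum_i \sum_j \sum_k \sum_l H i j k l.

Let eq_big4 H K : (forall i j k l, H i j k l = K i j k l) -> big4 H = big4 K.
Proof. by move=> HK; do 4![apply: eq_bigr => ? _]; exact: HK. Qed.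

Let big4B H K : big4 H - big4 K = big4 (fun i j k l => H i j k l - K i j k l).
Proof. by rewrite /big4; do 4![rewrite -sumrB; apply: eq_bigr => ? _]. Qed.

Let big4D H K : big4 H + big4 K = big4 (fun i j k l => H i j k l + K i j k l).
Proof. by rewrite /big4; do 4![rewrite -big_split; apply: eq_bigr => ? _]. Qed.

Let big4_swap H : big4 H = big4 (fun k l i j => H i j k l).
Proof.
rewrite /big4; under eq_bigr do rewrite exchange_big /=; rewrite exchange_big /=.
apply: eq_bigr => p _; under eq_bigr do rewrite exchange_big /=.
exact: exchange_big.
Qed.

Let big4_swap12 H : big4 H = big4 (fun j i k l => H i j k l).
Proof. exact: exchange_big. Qed.

Let big4_swap34 H : big4 H = big4 (fun i j l k => H i j k l).
Proof. by do 2![apply: eq_bigr => ? _]; exact: exchange_big. Qed.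

Let bivsum_mul A B : bivsum A *m bivsum B =
  big4 (fun i j k l => (A i j * B k l) *: (biv i j *m biv k l)).
Proof.
rewrite mulmx_suml; apply: eq_bigr => i _; rewrite mulmx_suml; apply: eq_bigr => j _.
rewrite mulmx_sumr; apply: eq_bigr => k _; rewrite mulmx_sumr; apply: eq_bigr => l _.
by rewrite -scalemxAl -scalemxAr scalerA.
Qed.

Let bivsum_mulmx A B : bivsum (A *m B) *+ 2 =
  big4 (fun i j k l => (A i j * B k l) *: ((2 *+ (j == k)) *: biv i l)).
Proof.
rewrite big4_swap34 -sumrMnl; apply: eq_bigr => i _; rewrite exchange_big /= -sumrMnl.
apply: eq_bigr => l _; rewrite mxE scaler_suml -sumrMnl; apply: eq_bigr => j _.
rewrite (bigD1 j) //= eqxx big1 ?addr0 => [|k /negPf kj]; last first.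
  by rewrite eq_sym kj mulr0n scale0r scaler0.
by rewrite mulr1n scaler_nat scalerMnr.
Qed.

(** Summing [biv_comm], the four families of leftover terms are the entries of
    [A *m B], [A^T *m B], [B *m A^T] and [B *m A]; for skew [A] they agree in pairs. *)
Lemma bivsum_comm A B : A^T = - A ->
  bivsum A *m bivsum B - bivsum B *m bivsum A = bivsum (A *m B - B *m A) *+ 4.
Proof.
move=> As; have AT i j : A i j = (- A) j i by rewrite -As mxE.
rewrite !bivsum_mul [X in _ - X]big4_swap big4B.
under eq_big4 => i j k l do
  rewrite [B k l * _]mulrC -scalerBr biv_comm scalerDr !scalerBr.
rewrite -big4D -!big4B -bivsum_mulmx.
have -> : big4 (fun i j k l => (A i j * B k l) *: ((2 *+ (i == k)) *: biv j l)) =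
    bivsum (- A *m B) *+ 2.
  by rewrite bivsum_mulmx big4_swap12; apply: eq_big4 => *; rewrite AT.
have -> : big4 (fun i j k l => (A i j * B k l) *: ((2 *+ (j == l)) *: biv k i)) =
    bivsum (B *m - A) *+ 2.
  rewrite bivsum_mulmx big4_swap big4_swap34; apply: eq_big4 => i j k l.
  by rewrite AT mulrC eq_sym.
have -> : big4 (fun i j k l => (A i j * B k l) *: ((2 *+ (i == l)) *: biv k j)) =
    bivsum (B *m A) *+ 2.
  by rewrite bivsum_mulmx big4_swap; apply: eq_big4 => i j k l; rewrite mulrC eq_sym.
rewrite mulNmx mulmxN bivsumD !bivsumN; set X := bivsum _; set Y := bivsum _.
by rewrite !mulNrn opprK -mulr2n -opprD -mulr2n -!mulrnA mulrnBl.
Qed.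
End CliffordFamily.

(** * Triality *)

Section TrialityTables.
Local Open Scope nat_scope.
Local Notation table := (seq (bool * nat)).

Definition parity3 k := odd k (+) odd k./2 (+) odd k./2./2.
(** The matrix of index [i] sends coordinates by [r |-> i xor r], with a sign that is a
    linear character of the column, given by [twist i].  The characters are
    such that the products with the transposes anticommute as a Clifford family has
    to, so that e_i e_r = +- e_(i xor r) multiplies norms, as the octonions do; they
    are one solution for which the half-spin map is an involution and each
    [cliff_biv (2 * b) (2 * b).+1] is a block diagonal matrix of blocks +-J_1. *)
Definition twist i := nth 0 [:: 0; 1; 3; 6; 7; 4; 5; 2] i.
Definition cliff i : table :=
  mkseq (fun r => let k := Nat.lxor i r in (parity3 (Nat.land (twist i) k), k)) 8.
Definition cliffT i : table :=
  mkseq (fun k => (parity3 (Nat.land (twist i) k), Nat.lxor i k)) 8.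
Definition cliff_biv i j := mmul (cliff i) (cliffT j).
Definition flip2 k l : table := mkseq (fun i => ((i == k) || (i == l), i)) 8.

Definition all8 (P : pred nat) := all P (iota 0 8).

Lemma all8P (P : pred nat) : all8 P -> forall i : 'I_8, P i.
Proof. by move=> /allP H i; apply: H; rewrite mem_iota /= ltn_ord. Qed.

Lemma wf_cliff : all8 (fun i => wf_tab 8 (cliff i) && wf_tab 8 (cliffT i)).
Proof. by []. Qed.

Lemma cliff_cliffT : all8 (fun i => cliff_biv i i == mconst false 8).
Proof. by []. Qed.

Lemma cliff_anti : all8 (fun i => all8 (fun j => (i == j) ||
  (cliff_biv i j == mneg (cliff_biv j i)) &&
  (mmul (cliffT i) (cliff j) == mneg (mmul (cliffT j) (cliff i))))).
Proof. by []. Qed.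

(** A triple that witnesses the spin covering: Y M_i = +- M_i Y', with Y = M_k M_l^T,
    Y' = M_k^T M_l and the sign of the diagonal matrix at [i]. *)
Lemma cliff_biv_flip : all8 (fun k => all8 (fun l => (k == l) || all8 (fun i =>
  mmul (cliff_biv k l) (cliff i) ==
  (if (i == k) || (i == l) then mneg else id) (mmul (cliff i) (mmul (cliffT k) (cliff l)))))).
Proof. by []. Qed.

Definition entry m r c : int :=
  if (row_of m r).2 == c then ((-1) ^+ (row_of m r).1)%R else 0%R.

Definition signed_entries (ts : seq (bool * table)) r c : int :=
  foldr (fun (x : bool * table) t => (-1) ^+ x.1 * entry x.2 r c + t)%R 0%R ts.

Definition cliff_biv_terms m : seq (bool * table) :=
  [seq ((row_of m i).1, cliff_biv i (row_of m i).2) | i <- iota 0 8].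

Definition elem_test p q (ts : seq (bool * table)) :=
  all8 (fun r => all8 (fun c => signed_entries ts r c ==
    (((r == p) && (c == q))%:R - ((r == q) && (c == p))%:R :> int)%R *+ 8)%R).

(** The half-spin map sends [cliff_biv p q] back to a multiple of E_pq - E_qp. *)
Lemma cliff_biv_sum : all8 (fun p => all8 (fun q => (p == q) ||
  elem_test p q (cliff_biv_terms (cliff_biv p q)))).
Proof. by []. Qed.
End TrialityTables.

Section Triality.
Local Open Scope ring_scope.
Variable R : realType.
Local Notation so := (so R 8).
Implicit Types (i j p q : 'I_8).

Lemma wf_cliff8 i : wf_tab 8 (cliff i) /\ wf_tab 8 (cliffT i).
Proof. by have /andP := all8P wf_cliff i. Qed.

Lemma wf_cliff_biv i j : wf_tab 8 (cliff_biv i j).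
Proof. by have [wi _] := wf_cliff8 i; have [_ wj] := wf_cliff8 j; exact: wf_mmul. Qed.

Definition cliff_mx i : 'M[R]_8 := mono_mx R 8 (cliff i).

Lemma cliff_mx_tr i : (cliff_mx i)^T = mono_mx R 8 (cliffT i).
Proof.
have [wi wTi] := wf_cliff8 i; have /eqP MMT := mono_mx_trE R wi.
have e : cliff_mx i *m mono_mx R 8 (cliffT i) = 1%:M.
  rewrite -mono_mxM // -/(cliff_biv i i) (eqP (all8P cliff_cliffT i)) mono_mx_const.
  by rewrite expr0 scale1r.
by rewrite -[RHS]mul1mx -(mulmx1C MMT) -mulmxA e mulmx1.
Qed.

Lemma biv_cliff_mx i j : biv cliff_mx i j = mono_mx R 8 (cliff_biv i j).
Proof. by have [wi _] := wf_cliff8 i; rewrite /biv cliff_mx_tr -mono_mxM. Qed.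

Lemma cliff_mx_MMT i j :
  cliff_mx i *m (cliff_mx j)^T = (2 *+ (i == j))%:M - cliff_mx j *m (cliff_mx i)^T.
Proof.
have [<-|ij] := eqVneq i j.
  have [wi _] := wf_cliff8 i; have /eqP := mono_mx_trE R wi; rewrite -/(cliff_mx i) => ->.
  by rewrite mulr1n -[2]/(1 + 1) raddfD addrK.
rewrite mulr0n raddf0 sub0r -![_ *m _]/(biv cliff_mx _ _) !biv_cliff_mx.
rewrite -mono_mx_mneg ?wf_cliff_biv //.
have := all8P (all8P cliff_anti i) j; rewrite val_eqE (negPf ij) /=.
by case/andP => /eqP -> _.
Qed.

Lemma cliff_mx_MTM i j :
  (cliff_mx i)^T *m cliff_mx j = (2 *+ (i == j))%:M - (cliff_mx j)^T *m cliff_mx i.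
Proof.
have [wi wTi] := wf_cliff8 i; have [wj wTj] := wf_cliff8 j.
have [<-|ij] := eqVneq i j.
  have /eqP/mulmx1C := mono_mx_trE R wi; rewrite -/(cliff_mx i) => ->.
  by rewrite mulr1n -[2]/(1 + 1) raddfD addrK.
rewrite mulr0n raddf0 sub0r !cliff_mx_tr -!mono_mxM // -mono_mx_mneg ?wf_mmul //.
have := all8P (all8P cliff_anti i) j; rewrite val_eqE (negPf ij) /=.
by case/andP => _ /eqP ->.
Qed.

Definition triality_mx (A : 'M[R]_8) : 'M[R]_8 := 4^-1 *: bivsum cliff_mx A.

Lemma triality_mx_linear : linear triality_mx.
Proof.
move=> a A B; rewrite /triality_mx bivsumD bivsumZ scalerDr !scalerA.
by rewrite [a * _]mulrC.
Qed.

Fact triality_subproof (A : so) : triality_mx A \in @skew R 8.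
Proof.
rewrite inE /triality_mx; apply/eqP.
have -> : (4^-1 *: bivsum cliff_mx A)^T = 4^-1 *: (bivsum cliff_mx A)^T.
  by apply/matrixP => r c; rewrite !mxE.
by rewrite bivsum_tr soP bivsumN scalerN.
Qed.

Definition triality_so (A : so) : so := So (triality_subproof A).

Lemma triality_so_linear : linear triality_so.
Proof. by move=> a A B; apply: val_inj; rewrite /= triality_mx_linear. Qed.

Lemma triality_so_lie : {morph triality_so : A B / lie A B}.
Proof.
move=> A B; apply: val_inj; rewrite /= /triality_mx -!scalemxAl -!scalemxAr !scalerA.
rewrite -scalerBr.
rewrite (bivsum_comm cliff_mx_MMT cliff_mx_MTM _ (soP A)) -scaler_nat scalerA.
by congr (_ *: _); rewrite -mulrA mulVf ?mulr1 // pnatr_eq0.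
Qed.

Lemma bivsum_delta p q : bivsum cliff_mx (delta_mx p q) = biv cliff_mx p q.
Proof.
rewrite /bivsum (bigD1 p) //= (bigD1 q) //= mxE !eqxx scale1r.
rewrite [X in _ + X + _]big1 => [|j /negPf qj]; last by rewrite mxE qj andbF scale0r.
rewrite addr0 big1 ?addr0 // => i /negPf pi; rewrite big1 // => j _.
by rewrite mxE pi scale0r.
Qed.

Lemma triality_elem p q : p != q ->
  triality_mx (elem_so R p q) = 2^-1 *: mono_mx R 8 (cliff_biv p q).
Proof.
move=> pq; rewrite /triality_mx /= bivsumD bivsumN !bivsum_delta -(biv_cliff_mx p q).
have -> : biv cliff_mx q p = - biv cliff_mx p q.
  by rewrite /biv cliff_mx_MMT eq_sym (negPf pq) mulr0n raddf0 sub0r.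
rewrite opprK -mulr2n -scaler_nat scalerA; congr (_ *: _).
by rewrite (natrM _ 2 2) invfM -mulrA mulVf ?mulr1 // pnatr_eq0.
Qed.

Lemma mono_entry m (r c : 'I_8) : mono_mx R 8 m r c = (entry m r c)%:~R.
Proof. by rewrite mxE /entry; case: eqP => _; rewrite ?rmorph_sign. Qed.

Lemma bivsum_mono m : wf_tab 8 m -> bivsum cliff_mx (mono_mx R 8 m) =
  \sum_(x <- cliff_biv_terms m) (-1) ^+ x.1 *: mono_mx R 8 x.2.
Proof.
move=> wm; rewrite big_map -[X in iota 0 X]subn0 -/(index_iota 0 8) big_mkord.
apply: eq_bigr => i _; pose k := Ordinal (wf_lt wm (ltn_ord i)).
rewrite (bigD1 k) //= mxE /= eqxx mulr1n biv_cliff_mx big1 ?addr0 // => j.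
by rewrite -val_eqE /= mxE eq_sym => /negPf ->; rewrite scale0r.
Qed.

Lemma triality_elemK p q : triality_so (triality_so (elem_so R p q)) = elem_so R p q.
Proof.
have [->|pq] := eqVneq p q.
  have rho0 : triality_mx 0 = 0 by rewrite /triality_mx -(scale0r 0) bivsumZ !scale0r scaler0.
  by apply: val_inj; rewrite /= subrr !rho0.
apply: val_inj; rewrite [LHS]/= triality_elem // /triality_mx bivsumZ.
rewrite bivsum_mono ?wf_cliff_biv //.
have := all8P (all8P cliff_biv_sum p) q; rewrite val_eqE (negPf pq) /= => test.
apply/matrixP => r c; rewrite !mxE.
have /eqP := all8P (all8P test r) c; set ts := cliff_biv_terms _.
have -> : (\sum_(x <- ts) (-1) ^+ x.1 *: mono_mx R 8 x.2) r c
    = (signed_entries ts r c)%:~R.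
  elim: ts => [|x ts IH]; first by rewrite big_nil mxE.
  by rewrite big_cons mxE IH mxE mono_entry /= intrD intrM rmorph_sign.
move=> ->; rewrite rmorphMn rmorphB !rmorph_nat !val_eqE; move: (_ - _) => z.
by rewrite -(mulr_natl z) (natrM _ 2 4) !mulrA mulfVK ?mulVf ?mul1r ?pnatr_eq0.
Qed.

Lemma triality_soK : involutive triality_so.
Proof.
pose rhoL : {linear so -> so} :=
  HB.pack triality_so (GRing.isLinear.Build _ _ _ _ _ triality_so_linear).
move=> A; rewrite -[LHS]/(rhoL (rhoL A)) [A in LHS]so_expand !linearZ_LR [RHS]so_expand.
congr (_ *: _); rewrite !linear_sum; apply: eq_bigr => i _; rewrite !linear_sum.
by apply: eq_bigr => j _; rewrite !linearZ_LR; congr (_ *: _); exact: triality_elemK.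
Qed.

Fact triality_aut_subproof : `[< is_lie_aut triality_so >].
Proof.
apply/asboolP; split; last exact: triality_so_lie.
  exact: triality_so_linear.
exact: inv_bij triality_soK.
Qed.

(** An automorphism of order 2 that no element of O(8) induces: it maps the class of a
    diagonal matrix with two entries -1 to that of a matrix without real eigenvalues. *)
Definition triality : aut_so R 8 := AutSo triality_aut_subproof.

Lemma triality2 : (triality * triality)%g = 1%g.
Proof. by apply/val_inj/funext => A; exact: triality_soK. Qed.

Lemma wf_flip2 (k l : nat) : wf_tab 8 (flip2 k l).
Proof.
rewrite /wf_tab size_mkseq eqxx /mkseq all_map -map_comp map_id iota_uniq andbT.
by apply/allP => i; rewrite mem_iota.
Qed.

Lemma row_of_flip2 (k l i : nat) : (i < 8)%N ->
  row_of (flip2 k l) i = ((i == k) || (i == l), i).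
Proof. by move=> i8; rewrite /row_of nth_mkseq. Qed.

(** In A_ij M_i M_j^T a change of sign of A_ij can be moved to M_i and M_j, and there
    it is a multiplication by Y on the left ([cliff_biv_flip]). *)
Lemma triality_flip2 (k l : 'I_8) : k != l ->
  cj triality (Ad_tab R (flip2 k l)) = Ad_tab R (cliff_biv k l).
Proof.
move=> kl; apply: cj_eqP; apply/val_inj/funext => A; apply: val_inj.
rewrite /= !val_orth_tab ?wf_flip2 ?wf_cliff_biv //.
set Y := mono_mx R 8 (cliff_biv k l).
pose t i := (i == k) || (i == l).
have entryE i j : (mono_mx R 8 (flip2 k l) *m A *m (mono_mx R 8 (flip2 k l))^T) i j
    = (-1) ^+ t i * (-1) ^+ t j * A i j.
  by rewrite (mono_mx_conj _ (row_of_flip2 k l (ltn_ord i)) (row_of_flip2 k l (ltn_ord j))).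
have [_ wTk] := wf_cliff8 k; have [wl _] := wf_cliff8 l.
pose Y' := mono_mx R 8 (mmul (cliffT k) (cliff l)).
have wY' : wf_tab 8 (mmul (cliffT k) (cliff l)) by exact: wf_mmul.
have Y'T : Y' *m Y'^T = 1%:M by apply/eqP; exact: mono_mx_trE.
have YM i : Y *m cliff_mx i = (-1) ^+ t i *: (cliff_mx i *m Y').
  have [wi _] := wf_cliff8 i; rewrite -!mono_mxM ?wf_cliff_biv //.
  have := all8P (all8P cliff_biv_flip k) l.
  rewrite val_eqE (negPf kl) orFb => /all8P/(_ i)/eqP ->.
  rewrite !val_eqE -/(t i); case: (t i); last by rewrite expr0 scale1r.
  by rewrite mono_mx_mneg ?wf_mmul // expr1 scaleN1r.
rewrite /triality_mx -scalemxAr -scalemxAl; congr (_ *: _).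
rewrite mulmx_sumr mulmx_suml; apply: eq_bigr => i _.
rewrite mulmx_sumr mulmx_suml; apply: eq_bigr => j _.
rewrite entryE -scalemxAr -scalemxAl [_ * _ * A i j]mulrC -scalerA; congr (_ *: _).
rewrite /biv mulmxA YM -(mulmxA _ _ Y^T) -trmx_mul YM.
have -> : ((-1) ^+ t j *: (cliff_mx j *m Y'))^T = (-1) ^+ t j *: (Y'^T *m (cliff_mx j)^T).
  by apply/matrixP => r c; rewrite -trmx_mul !mxE.
by rewrite -scalemxAl -scalemxAr scalerA mulmxA -(mulmxA _ Y') Y'T mulmx1.
Qed.
End Triality.

(** * The diagonal group *)

Section DiagonalTables.
Local Open Scope nat_scope.
Local Notation table := (seq (bool * nat)).

Fixpoint bits n : seq (seq bool) :=
  if n is n'.+1 then [seq b :: l | b <- [:: false; true], l <- bits n'] else [:: [::]].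

Lemma mem_bits (l : seq bool) : l \in bits (size l).
Proof.
by elim: l => // b l IH; apply/allpairsP; exists (b, l); split=> //; case: b.
Qed.

Definition diag_table (l : seq bool) : table := zip l (iota 0 8).

Definition even_flips : seq table := [seq flip2 0 k | k <- iota 1 7].

Lemma wf_diag_table : all (fun l => wf_tab 8 (diag_table l)) (bits 8).
Proof. by []. Qed.

Lemma flip2_even : all8 (fun k => all8 (fun l => (k == l) ||
  has (eq_pm (flip2 k l)) (tab_span even_flips))).
Proof. by []. Qed.

Lemma flip2_diag : all8 (fun k => all8 (fun l =>
  has (fun s => flip2 k l == diag_table s) (bits 8))).
Proof. by []. Qed.

(** Trace (8 - 2n)^2 - 8 = 28 forces n = 1 or n = 7 entries -1, and these two cases
    differ by -I.  As [tr_so] is twice the trace, 28 stands for trace 14. *)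
Lemma reflection_of_trace : all (fun l => (tab_char (diag_table l) == Posz 28) ==>
  has (fun j => eq_pm (diag_table l) (flip2 j j)) (iota 0 8)) (bits 8).
Proof. by []. Qed.

Lemma reflections_distinct : all8 (fun k => all8 (fun l =>
  eq_pm (flip2 k k) (flip2 l l) ==> (k == l))).
Proof. by []. Qed.

Lemma reflection_trace : all8 (fun k => tab_char (flip2 k k) == Posz 28).
Proof. by []. Qed.

Lemma flip2_mul : all8 (fun k => all8 (fun l =>
  (k == l) || (mmul (flip2 k k) (flip2 l l) == flip2 k l))).
Proof. by []. Qed.
End DiagonalTables.

Section DiagonalGroup.
Local Open Scope ring_scope.
Local Open Scope classical_set_scope.
Variable R : realType.
Local Notation Ad_tab := (Ad_tab R).
Local Notation aut := (aut_so R 8).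
Local Notation so := (so R 8).
Implicit Types (g h : aut) (i j k l : 'I_8).

Lemma is_diagP (X : 'M[R]_8) : is_diag_mx X <-> forall i j, i != j -> X i j = 0.
Proof. by split=> [/is_diag_mxP dX i j /dX|dX]; last by apply/is_diag_mxP => i j /dX. Qed.

Definition diagG : set aut := @AdPO R 8 @` @F22 R.

Lemma diagG_Ad g : diagG g <-> exists2 X : ortho R 8, is_diag_mx X & g = Ad X.
Proof.
split=> [[_ [X dX <-] <-]|[X dX ->]]; first by exists X => //; rewrite AdPO_cls.
by exists (cls X); rewrite ?AdPO_cls //; exists X.
Qed.

Lemma mono_diag_table (l : seq bool) i j :
  size l = 8%N -> mono_mx R 8 (diag_table l) i j = (-1) ^+ nth false l i *+ (i == j).
Proof.
move=> sl; have ni : nth 0%N (iota 0 8) i = i by rewrite nth_iota.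
by rewrite mxE /row_of nth_zip ?size_iota // [(_, _).1]/= [(_, _).2]/= ni.
Qed.

Lemma size_bits (l : seq bool) n : l \in bits n -> size l = n.
Proof.
elim: n l => [l|n IH l]; first by rewrite inE => /eqP ->.
by move=> /allpairsP[[b l'] /= [_ /IH <- ->]].
Qed.

Lemma diagG_table g : diagG g <-> exists2 l, l \in bits 8 & g = Ad_tab (diag_table l).
Proof.
split=> [/diagG_Ad[X /is_diagP dX0 ->]|[l lb ->]]; last first.
  apply/diagG_Ad; exists (orth_tab R 8 (diag_table l)) => //.
  rewrite val_orth_tab ?(allP wf_diag_table) //; apply/is_diagP => i j ij.
  by rewrite mono_diag_table ?(size_bits lb) // (negPf ij).
pose l := [seq X i i == -1 | i <- enum 'I_8].
have sl : size l = 8%N by rewrite size_map size_enum_ord.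
have lb : l \in bits 8 by rewrite -sl; exact: mem_bits.
exists l => //; congr Ad; apply: orth_tab_eq; first exact: (allP wf_diag_table).
apply/matrixP => i j; rewrite mono_diag_table // (nth_map ord0) ?size_enum_ord //.
rewrite nth_ord_enum; have [<-|/dX0 ->] := eqVneq i j; last by rewrite mulr0n.
have : X i i ^+ 2 == 1.
  have /matrixP/(_ i i) := orthoP X; rewrite !mxE eqxx (bigD1 i) //= big1 => [|k ki].
    by rewrite addr0 mxE expr2 => ->.
  by rewrite dX0 ?mul0r // eq_sym.
rewrite mulr1n sqrf_eq1 => /orP[] /eqP ->; last by rewrite eqxx expr1.
by case: eqP => // /eqP; rewrite -subr_eq0 opprK pnatr_eq0.
Qed.

Lemma diagG_flip2 k l : diagG (Ad_tab (flip2 k l)).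
Proof.
have /hasP[s sb /eqP ->] := all8P (all8P flip2_diag k) l.
by apply/diagG_table; exists s.
Qed.

Lemma diagG_commute g h : diagG g -> diagG h -> commute g h.
Proof.
move=> /diagG_Ad[X /is_diagP dX ->] /diagG_Ad[Y /is_diagP dY ->].
rewrite /commute -!AdM; congr Ad; apply: val_inj => /=; apply/matrixP => i j.
rewrite !mxE; apply: eq_bigr => k _.
have [<-|ik] := eqVneq i k; last by rewrite (dX _ _ ik) (dY _ _ ik) !mul0r.
have [<-|ij] := eqVneq i j; first exact: mulrC.
by rewrite (dX _ _ ij) (dY _ _ ij) !mulr0.
Qed.

(** The classes of diagonal matrices of determinant 1; [flip2 0 k] is the product of
    the reflections at 0 and k. *)
Definition evenG : set aut := @tab_group R even_flips.

Lemma evenG_flip2 k l : k != l -> evenG (Ad_tab (flip2 k l)).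
Proof.
move=> kl; have := all8P (all8P flip2_even k) l; rewrite val_eqE (negPf kl) orFb.
have wflips : all (wf_tab 8) even_flips by [].
move=> /hasP[m ms km]; rewrite (Ad_tab_eq_pm R (allP (wf_span wflips) _ ms) km).
exact: tab_span_gen.
Qed.

Lemma evenG_sub_diagG : evenG `<=` diagG.
Proof.
apply: gen_min => [|_ /mapP[_ /mapP[k k7 ->] ->]].
  split; rewrite ?inE.
    apply/diagG_Ad; exists 1%g; last by rewrite Ad1.
    by apply/is_diagP => i j /negPf ij; rewrite /= mxE ij.
  move=> x y; rewrite !inE => /diagG_Ad[X /is_diagP dX ->] /diagG_Ad[Y /is_diagP dY ->].
  apply/diagG_Ad; exists (X * Y^-1)%g.
    apply/is_diagP => i j ij; rewrite /= mxE big1 // => k _; rewrite mxE.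
    have [ik|/dX -> ] := eqVneq i k; last by rewrite mul0r.
    by rewrite dY ?mulr0 // -ik eq_sym.
  rewrite AdM; congr (_ * _)%g; apply: (mulIg (Ad Y)); rewrite mulVg -AdM mulVg.
  by rewrite Ad1.
have k8 : (k < 8)%N by move: k7; rewrite mem_iota => /andP[].
exact: (diagG_flip2 ord0 (Ordinal k8)).
Qed.

Lemma Ad_flip2E k l (A : so) i j : so_mx (Ad_tab (flip2 k l) A) i j =
  (-1) ^+ ((i == k) || (i == l)) * (-1) ^+ ((j == k) || (j == l)) * A i j.
Proof.
by rewrite (Ad_tab_entry _ (wf_flip2 k l) (row_of_flip2 _ _ _) (row_of_flip2 _ _ _)).
Qed.

Lemma exists_other (s : seq 'I_8) : (size s < 8)%N -> exists l, l \notin s.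
Proof.
move=> ss; apply/existsP; apply: contraLR ss; rewrite negb_exists => /forallP all_s.
rewrite -leqNgt; have : {subset enum 'I_8 <= s} by move=> l _; have := all_s l; rewrite negbK.
by move/(uniq_leq_size (enum_uniq _)); rewrite size_enum_ord.
Qed.

Lemma elem_so_neq0 i j : i != j -> elem_so R i j <> 0.
Proof.
move=> ij /(congr1 (fun A : so => A i j)); rewrite elem_soE mxE !eqxx (negPf ij) subr0.
by move/eqP; rewrite oner_eq0.
Qed.

Lemma lie_elem i j k : i != j -> j != k -> i != k ->
  lie (elem_so R i j) (elem_so R j k) = elem_so R i k.
Proof.
move=> ij jk ik; apply: val_inj => /=.
rewrite !(mulmxBl, mulmxBr) !mul_delta_mx_cond !eqxx.
rewrite (eq_sym k i) (eq_sym k j) (eq_sym j i) (negPf ij) (negPf jk) (negPf ik).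
by rewrite !mulr0n !mulr1n !subr0 !sub0r opprK.
Qed.

Lemma lieZZ a b (A B : so) : so_mx (lie (a *: A) (b *: B)) = (a * b) *: so_mx (lie A B).
Proof. by rewrite /= -!scalemxAl -!scalemxAr !scalerA scalerBr [b * a]mulrC. Qed.

Section WeightSpaces.
Variable g : aut.
Hypothesis gC : g \in centralizer evenG.
Let c i j : R := so_mx (g (elem_so R i j)) i j.

Lemma Ad_flip2_g k l (A : so) : k != l -> Ad_tab (flip2 k l) (g A) = g (Ad_tab (flip2 k l) A).
Proof.
move=> /evenG_flip2 Fkl; have /centralizerP/(_ _ Fkl) e := gC.
by have /(congr1 (fun f : aut => f A)) := e.
Qed.

(** For every pair of indices other than i, j some [flip2 k l] has a different sign on
    it than on i, j; since the image of E_ij - E_ji is an eigenvector with the same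
    signs, its other entries vanish. *)
Lemma weight_elem i j : i != j -> g (elem_so R i j) = c i j *: elem_so R i j.
Proof.
move=> ij; set u := g _.
have sep a b k l : k != l ->
    ((a == k) || (a == l)) (+) ((b == k) || (b == l)) !=
    ((i == k) || (i == l)) (+) ((j == k) || (j == l)) -> so_mx u a b = 0.
  move=> kl; set x := _ (+) _; set y := _ (+) _ => xy.
  have fu : Ad_tab (flip2 k l) u = (-1) ^+ y *: u.
    rewrite /u Ad_flip2_g // -autZ; congr (g _); apply: val_inj; apply/matrixP => p q.
    rewrite -[LHS]/(so_mx _ p q) -[RHS]/(so_mx _ p q) Ad_flip2E so_mxZ [RHS]mxE elem_soE.
    rewrite -signr_addb /y; case: (eqVneq p i) => [->|pi] /=.
      case: (eqVneq q j) => [-> //|qj]; case: (eqVneq i j) ij => //= _ _.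
      by rewrite subrr !mulr0.
    case: (eqVneq p j) => [->|pj] /=; last by rewrite subrr !mulr0.
    case: (eqVneq q i) => [->|qi]; last by rewrite subrr !mulr0.
    by rewrite addbC.
  have /(congr1 (fun A : so => A a b)) := fu.
  rewrite Ad_flip2E so_mxZ [RHS]mxE -signr_addb -/x => /eqP.
  rewrite -subr_eq0 -mulrBl mulf_eq0 => /orP[|/eqP //].
  move: xy; clear fu; clearbody x y.
  case: x; case: y => //= _; rewrite ?expr0 ?expr1 -?opprD ?opprK ?oppr_eq0;
    by rewrite -mulr2n pnatr_eq0.
apply: val_inj; apply/matrixP => a b.
rewrite -[LHS]/(so_mx u a b) -[RHS]/(so_mx _ a b) so_mxZ [RHS]mxE elem_soE.
have outside a' b' : a' != b' -> a' != i -> a' != j -> so_mx u a' b' = 0.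
  move=> ab ai aj.
  have [l] := @exists_other [:: a'; b'; i; j] isT; rewrite !inE !negb_or.
  case/and4P => la lb li lj; apply: (sep _ _ a' l); first by rewrite eq_sym.
  rewrite eqxx (eq_sym b') (negPf ab) (eq_sym b') (negPf lb).
  rewrite (eq_sym i) (negPf ai) (eq_sym i) (negPf li).
  by rewrite (eq_sym j) (negPf aj) (eq_sym j) (negPf lj).
have anti a' b' : so_mx u a' b' = - so_mx u b' a' by exact: so_antisym.
have diag0 a' : so_mx u a' a' = 0.
  apply/eqP; have /eqP := anti a' a'; rewrite -subr_eq0 opprK -mulr2n -mulr_natl.
  by rewrite mulf_eq0 pnatr_eq0.
have [->|ab] := eqVneq a b; first by rewrite diag0 andbC subrr mulr0.
have [ai|ai] := eqVneq a i; have [aj|aj] := eqVneq a j => /=.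
- by rewrite -ai -aj eqxx in ij.
- rewrite subr0; have [->|bj] := eqVneq b j; first by rewrite ai mulr1.
  by rewrite mulr0 anti outside ?oppr0 // 1?eq_sym // -ai.
- rewrite sub0r; have [->|bi] := eqVneq b i; last first.
    by rewrite oppr0 mulr0 anti outside ?oppr0 // 1?eq_sym // -aj.
  by rewrite aj anti mulrN1.
by rewrite outside // subrr mulr0.
Qed.

Let c_sym i j : i != j -> c i j = c j i.
Proof.
move=> ij; have eN : elem_so R i j = (-1) *: elem_so R j i.
  by apply: val_inj; rewrite /= scaleN1r opprB.
by rewrite /c {1}eN autZ so_mxZ mxE mulN1r -so_antisym.
Qed.

Let c_mul i j k : i != j -> j != k -> i != k -> c i j * c j k = c i k.
Proof.
move=> ij jk ik; have e := autL g (elem_so R i j) (elem_so R j k).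
move: e; rewrite lie_elem // !weight_elem // => /(congr1 (fun A : so => so_mx A i k)).
rewrite lieZZ lie_elem // so_mxZ !mxE !eqxx (negPf ik) subr0 !mulr1 => ->.
by [].
Qed.

Let c_neq0 i j : i != j -> c i j != 0.
Proof.
move=> ij; apply/eqP => c0; apply: (elem_so_neq0 ij).
have [_ /bij_inj gI _] := aut_soP g; apply: gI.
by rewrite weight_elem // c0 -(scale0r (elem_so R i j)) autZ !scale0r.
Qed.

Let c_sqr i j : i != j -> c i j ^+ 2 = 1.
Proof.
move=> ij; have [k] := @exists_other [:: i; j] isT; rewrite !inE negb_or => /andP[ki kj].
have ik : i != k by rewrite eq_sym.
have jk : j != k by rewrite eq_sym.
have ji : j != i by rewrite eq_sym.
have := c_mul ij jk ik; rewrite -(c_mul ji ik jk) (c_sym ji) mulrA -expr2.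
by rewrite -[RHS]mul1r => /(mulIf (c_neq0 ik)).
Qed.

(** The eigenvalues multiply like the brackets, [c i j * c j k = c i k], so they
    come from a choice of signs on the coordinates. *)
Lemma centralizer_evenG_sub : diagG g.
Proof.
pose d i : R := if i == ord0 then 1 else c ord0 i.
have d2 i : d i ^+ 2 == 1.
  by rewrite /d; case: (eqVneq i ord0) => [_|i0]; rewrite ?expr1n // c_sqr // eq_sym.
have cd i j : i != j -> c i j = d i * d j.
  move=> ij; rewrite /d; case: (eqVneq i ord0) => [i0|i0]; case: (eqVneq j ord0) => [j0|j0].
  - by rewrite i0 j0 eqxx in ij.
  - by rewrite mul1r i0.
  - by rewrite mulr1 c_sym // j0.
  by rewrite -(c_sym i0) c_mul // eq_sym.
pose X : 'M[R]_8 := diag_mx (\row_i d i).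
have XE i j : X i j = d i *+ (i == j) by rewrite !mxE.
have X_orth : X *m X^T == 1%:M.
  apply/eqP/matrixP => i j; rewrite tr_diag_mx mulmx_diag !mxE; congr (_ *+ _).
  by rewrite -expr2; exact/eqP.
apply/diagG_Ad; exists (Ortho X_orth); first exact: diag_mx_is_diag.
apply: eq_aut => i j ij; rewrite weight_elem // cd //; apply: val_inj; apply/matrixP => p q.
rewrite -[LHS]/(so_mx _ p q) so_mxZ mxE.
rewrite -[RHS]/((X *m elem_so R i j *m X^T) p q) /X tr_diag_mx.
have -> (A : 'M[R]_8) (u v : 'rV_8) :
    (diag_mx u *m A *m diag_mx v) p q = u ord0 p * A p q * v ord0 q.
  by rewrite mul_mx_diag mxE mul_diag_mx mxE.
rewrite !elem_soE; rewrite !mxE.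
case: (eqVneq p i) => [->|pi] /=; last first.
  case: (eqVneq p j) => [->|pj] /=; last by rewrite subrr !(mulr0, mul0r).
  case: (eqVneq q i) => [->|qi] /=; last by rewrite subrr !(mulr0, mul0r).
  by rewrite sub0r !mulrN1 mulNr [d j * _]mulrC.
case: (eqVneq q j) => [->|qj] /=; first by rewrite (negPf ij) subr0 !mulr1.
by rewrite (negPf ij) subrr !(mulr0, mul0r).
Qed.
End WeightSpaces.

Lemma centralizer_evenG g : (g \in centralizer evenG) = (g \in centralizer diagG).
Proof.
apply/idP/idP => [/centralizer_evenG_sub gD|/centralizerP gC].
  by apply/centralizerP => x; exact: diagG_commute.
by apply/centralizerP => x /evenG_sub_diagG; exact: gC.
Qed.

Lemma diagG_centralizer g : diagG g <-> g \in centralizer evenG.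
Proof.
split=> [gD|]; last exact: centralizer_evenG_sub.
by apply/centralizerP => x /evenG_sub_diagG; exact: diagG_commute.
Qed.

Lemma normalizer_reflection g k : g \in normalizer diagG ->
  exists j, cj g (Ad_tab (flip2 k k)) = Ad_tab (flip2 j j).
Proof.
move=> gN; have /diagG_table[l lb gl] := normalizer_cj gN (diagG_flip2 k k).
have wl := allP wf_diag_table _ lb.
have tl : tab_char (diag_table l) == Posz 28.
  rewrite -(eqP (all8P reflection_trace k)); apply/eqP/(@intr_inj R).
  by rewrite -!tr_so_Ad_tab ?wf_flip2 // -gl tr_so_cj.
have /implyP/(_ tl)/hasP[j j8 lj] := allP reflection_of_trace _ lb.
have j8' : (j < 8)%N by move: j8; rewrite mem_iota.
exists (Ordinal j8'); rewrite gl; apply: Ad_tab_eq_pm lj; exact: wf_flip2.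
Qed.

Lemma Ad_flip2_mul k l : k != l ->
  Ad_tab (flip2 k l) = (Ad_tab (flip2 k k) * Ad_tab (flip2 l l))%g.
Proof.
move=> kl; rewrite -Ad_tabM ?wf_flip2 //; congr Ad_tab; apply/esym/eqP.
by have := all8P (all8P flip2_mul k) l; rewrite val_eqE (negPf kl).
Qed.

Lemma Ad_reflection_inj k l : Ad_tab (flip2 k k) = Ad_tab (flip2 l l) -> k = l.
Proof.
move=> /(Ad_tab_inj (wf_flip2 _ _) (wf_flip2 _ _)) kl; apply/val_inj/eqP.
exact: (implyP (all8P (all8P reflections_distinct k) l)).
Qed.

Lemma cj_inj g : injective (cj g).
Proof. exact: can_inj (cjK g). Qed.

Lemma evenG_gens x : x \in map Ad_tab even_flips ->
  exists2 k : 'I_8, k != ord0 & x = Ad_tab (flip2 (ord0 : 'I_8) k).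
Proof.
move=> /mapP[_ /mapP[k k7 ->] ->]; move: k7; rewrite mem_iota => /andP[k0 k8].
by exists (Ordinal k8) => //; rewrite -val_eqE -lt0n.
Qed.

Lemma normalizer_diagG_sub g : g \in normalizer diagG -> forall x, evenG x -> evenG (cj g x).
Proof.
move=> gN; apply: gen_cj; first exact: gen_group.
move=> _ /evenG_gens[k k0 ->]; rewrite Ad_flip2_mul 1?eq_sym // cjM.
have [i gi] := normalizer_reflection ord0 gN; have [j gj] := normalizer_reflection k gN.
rewrite gi gj -Ad_flip2_mul; first apply: evenG_flip2.
  all: apply: contra_neq k0 => ij; apply: Ad_reflection_inj; apply: (@cj_inj g).
  all: by rewrite gi gj ij.
Qed.

(** Each group determines the other: the diagonal group is the centraliser of its even
    part, and the even part is generated by products of two of the reflections,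
    which the normaliser of the diagonal group permutes. *)
Lemma normalizer_evenG g : (g \in normalizer evenG) = (g \in normalizer diagG).
Proof.
apply/idP/idP => gN.
  by apply: normalizer_intro => x /diagG_centralizer xC; apply/diagG_centralizer;
    apply: centralizer_cj => //; exact: normalizerV.
apply: normalizer_intro; apply: normalizer_diagG_sub => //; exact: normalizerV.
Qed.

Lemma perm_orth (s : {perm 'I_8}) : (perm_mx s : 'M[R]_8) *m (perm_mx s)^T == 1%:M.
Proof. by rewrite tr_perm_mx -perm_mxM mulgV perm_mx1. Qed.

Definition perm_aut (s : {perm 'I_8}) : aut := Ad (Ortho (perm_orth s)).

Lemma perm_autM s t : perm_aut (s * t)%g = (perm_aut s * perm_aut t)%g.
Proof. by rewrite /perm_aut -AdM; congr Ad; apply: val_inj; rewrite /= perm_mxM. Qed.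

Lemma perm_aut1 : perm_aut 1%g = 1%g.
Proof. by apply: (mulgI (perm_aut 1%g)); rewrite -perm_autM !mulg1. Qed.

Lemma perm_autV s : perm_aut s^-1%g = (perm_aut s)^-1%g.
Proof. by apply: (mulgI (perm_aut s)); rewrite -perm_autM !mulgV perm_aut1. Qed.

Lemma perm_conj (s : {perm 'I_8}) (A : 'M[R]_8) i j :
  (perm_mx s *m A *m (perm_mx s)^T) i j = A (s i) (s j).
Proof. by rewrite tr_perm_mx -row_permE -col_permE !mxE. Qed.

Lemma cj_Ad (X Y Z : ortho R 8) : ortho_mx X *m Y *m X^T = Z -> cj (Ad X) (Ad Y) = Ad Z.
Proof.
move=> e; apply: cj_eqP; rewrite -!AdM; congr Ad; apply: val_inj => /=.
by rewrite -e -mulmxA orthoTP mulmx1.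
Qed.

Lemma perm_aut_diagG s x : diagG x -> diagG (cj (perm_aut s) x).
Proof.
move=> /diagG_Ad[Y /is_diagP dY ->]; apply/diagG_Ad; set P := Ortho (perm_orth s).
exists (P * Y * P^-1)%g; last by apply: cj_Ad.
apply/is_diagP => i j ij /=; rewrite perm_conj dY //.
by apply: contra_neq ij; exact: perm_inj.
Qed.

Lemma perm_aut_normalizer s : perm_aut s \in normalizer diagG.
Proof.
by apply: normalizer_intro => x; rewrite -?perm_autV; exact: perm_aut_diagG.
Qed.

Lemma perm_aut_reflection s k :
  cj (perm_aut s) (Ad_tab (flip2 k k)) = Ad_tab (flip2 (s^-1%g k) (s^-1%g k)).
Proof.
apply: cj_Ad; rewrite !val_orth_tab ?wf_flip2 // /=; apply/matrixP => i j; rewrite perm_conj.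
rewrite !mxE !row_of_flip2 //= !val_eqE (inj_eq perm_inj) !orbb.
by rewrite (can2_eq (permK s) (permKV s)).
Qed.

Lemma centralizer_diagG g : (forall k, cj g (Ad_tab (flip2 k k)) = Ad_tab (flip2 k k)) ->
  g \in centralizer diagG.
Proof.
move=> gk; rewrite -centralizer_evenG; apply/centralizerP; apply: gen_commute.
move=> _ /evenG_gens[k k0 ->]; apply/cj_fix.
by rewrite Ad_flip2_mul 1?eq_sym // cjM !gk.
Qed.

(** The action on the eight reflections is faithful, since they generate the group. *)
Lemma weyl_diagG : group_isom (W diagG) {perm 'I_8}.
Proof.
apply: group_isom_sym; pose n s := NormalizerElt (perm_aut_normalizer s).
exists (fun s => weyl_class (n s)) => [s t|].
  by rewrite -weyl_classM; congr weyl_class; apply: val_inj; exact: perm_autM.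
rewrite -setTT_bijective; split=> // [s t _ _|w _].
  move=> /weyl_class_eqP /centralizerP stC; apply/permP => i.
  have /cj_fix := stC _ (diagG_flip2 (t i) (t i)).
  rewrite cj_comp perm_aut_reflection permK => /(congr1 (cj (perm_aut s))).
  by rewrite cjKV perm_aut_reflection => /Ad_reflection_inj e; rewrite {1}e permKV.
have /choice [f fP] : forall k, exists j,
    cj (val (repr w)) (Ad_tab (flip2 k k)) = Ad_tab (flip2 j j).
  by move=> k; apply: normalizer_reflection; exact: valP.
have fI : injective f.
  move=> k l kl; apply: Ad_reflection_inj; apply: (@cj_inj (val (repr w))).
  by rewrite !fP kl.
exists (perm fI)^-1%g => //; rewrite -[w]weyl_classK; apply/weyl_class_eqP.
apply: centralizer_diagG => k; rewrite cj_comp fP /= -perm_autV perm_aut_reflection.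
have -> : ((perm fI)^-1^-1^-1)%g = (perm fI)^-1%g by exact: invgK.
by rewrite -(permE fI) permK.
Qed.

(** Both groups being given by generators, it is enough to know [cj h] on one
    convenient list of tables that generates the first group. *)
Lemma gen_pairs h (ps : seq (seq (bool * nat) * seq (bool * nat))) gensA gensB :
  all (fun p => wf_tab 8 p.1 && wf_tab 8 p.2) ps -> all (wf_tab 8) gensB ->
  {in ps, forall p, cj h (Ad_tab p.1) = Ad_tab p.2} ->
  all (fun m => has (eq_pm m) (tab_span (map fst ps))) gensA ->
  all (fun p => has (eq_pm p.2) (tab_span gensB)) ps ->
  forall x, @tab_group R gensA x -> @tab_group R gensB (cj h x).
Proof.
move=> /allP wps wB hps /allP gA /allP pB; apply: gen_cj; first exact: gen_group.
have wfst : all (wf_tab 8) (map fst ps).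
  by apply/allP => _ /mapP[p /wps /andP[wp _] ->].
move=> _ /mapP[g /gA /hasP[e es ge] ->].
rewrite (Ad_tab_eq_pm R (allP (wf_span wfst) _ es) ge).
have {es}: gen [set x | x \in map Ad_tab (map fst ps)] (Ad_tab e) by exact: tab_span_gen.
apply: gen_cj; first exact: gen_group.
move=> _ /mapP[_ /mapP[p pps ->] ->]; rewrite hps //.
have /hasP[m ms pm] := pB _ pps; rewrite (Ad_tab_eq_pm R (allP (wf_span wB) _ ms) pm).
exact: tab_span_gen.
Qed.
End DiagonalGroup.

(** * Generators and stabiliser chains for F17, F18, F19 and F20 *)

Section Blocks.
Local Open Scope nat_scope.
Local Notation table := (seq (bool * nat)).

(** The letters of the 2 x 2 blocks: I_2, I_(1,1), J'_1 and J_1. *)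
Definition blk1 : table := mconst false 2.
Definition blkI : table := mdiag 1 (mconst true 1) (mconst false 1).
Definition blkP : table := manti 1 (mconst false 1) (mconst false 1).
Definition blkJ : table := manti 1 (mconst false 1) (mconst true 1).

Definition blocks (a b c d : table) : table := mdiag 4 (mdiag 2 a b) (mdiag 2 c d).

Definition all_blocks x := blocks x x x x.

Definition at_block i x : table :=
  let y k := if k == i then x else blk1 in blocks (y 0) (y 1) (y 2) (y 3).

Definition block_swap i j : table :=
  flatten [seq mshift (2 * (if k == i then j else if k == j then i else k)) blk1
          | k <- iota 0 4].

Definition tIpq p q : table := mdiag p (mconst true p) (mconst false q).

Definition gens17 : seq table :=
  [:: tIpq 4 4; tIpq 2 6; tIpq 6 2; all_blocks blkI; all_blocks blkP].
Definition gens18 : seq table :=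
  [:: tIpq 4 4; tIpq 2 6; tIpq 6 2; all_blocks blkI; blocks blkP blkP blkP blkJ].
Definition gens19 : seq table :=
  [:: tIpq 4 4; tIpq 2 6; tIpq 6 2; all_blocks blkI; blocks blkP blkP blkJ blkJ].
Definition gens20 : seq table :=
  [:: tIpq 4 4; tIpq 2 6; tIpq 6 2; blocks blkI blkI blkI blkJ; blocks blkP blkP blkJ blkI].

Definition simple_level s m := Level s [:: s] [::] (tab_span m).

(** The 12 candidates for the first point are the sign changes of one block and
    the classes of diag(J_1, +-J_1, +-J_1, +-J_1).  Block swaps and reflections of
    single blocks act transitively on either kind, and [triality] joins them.
    For the fourth point, E, the joining element is [half17], which maps it to D. *)
Definition levels17 : seq level :=
  [:: Level (tIpq 2 6) [:: tIpq 2 6; all_blocks blkJ] [::]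
        (tab_span [:: block_swap 0 1; block_swap 0 2; block_swap 0 3;
                      at_block 3 blkI; at_block 2 blkI; at_block 1 blkI]);
      simple_level (tIpq 4 4) [:: block_swap 1 2; block_swap 1 3];
      simple_level (tIpq 6 2) [:: block_swap 2 3];
      Level (all_blocks blkP) [:: all_blocks blkP; all_blocks blkI] [::]
        (tab_span [:: at_block 3 blkI; at_block 2 blkI; at_block 1 blkI;
                      at_block 3 blkP; at_block 2 blkP; at_block 1 blkP]);
      simple_level (all_blocks blkI) [:: at_block 3 blkP; at_block 2 blkP; at_block 1 blkP]].

Definition levels18 : seq level :=
  [:: simple_level (blocks blkP blkP blkP blkJ)
        [:: at_block 3 blkI; at_block 2 blkI; at_block 1 blkI];
      simple_level (tIpq 4 4) [:: block_swap 0 1; block_swap 1 2];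
      simple_level (tIpq 2 6) [:: block_swap 0 1];
      simple_level (all_blocks blkI) [:: at_block 3 blkJ; at_block 2 blkP; at_block 1 blkP]].

(** Traces would let the second point, the sign change of the first block, move
    to any of the four blocks; the last two are ruled out by [F19_excluded]. *)
Definition levels19 : seq level :=
  [:: simple_level (blocks blkP blkP blkJ blkJ)
        [:: mmul (block_swap 0 2) (block_swap 1 3);
            at_block 3 blkI; at_block 2 blkI; at_block 1 blkI];
      Level (tIpq 2 6) [:: tIpq 2 6] [:: tIpq 6 2; mmul (tIpq 6 2) (tIpq 4 4)]
        (tab_span [:: block_swap 0 1]);
      simple_level (tIpq 6 2) [:: block_swap 2 3];
      simple_level (all_blocks blkI) [:: at_block 3 blkJ; at_block 2 blkJ; at_block 1 blkP]].

(** The first orbit consists of the classes that agree up to block signs with one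
    of the last two generators; [half20] exchanges these.  The last point makes the
    points generate the group, and its orbit is a single element. *)
Definition levels20 : seq level :=
  [:: Level (blocks blkI blkI blkI blkJ)
        [:: blocks blkI blkI blkI blkJ; blocks blkP blkP blkJ blkI] [::]
        (tab_span [:: at_block 3 blkI; at_block 2 blkP; at_block 1 blkP;
                      at_block 3 blkJ; at_block 2 blkI; at_block 1 blkI]);
      simple_level (blocks blkP blkP blkJ blkI)
        [:: at_block 3 blkJ; at_block 2 blkI; at_block 1 blkI];
      simple_level (tIpq 2 6) [:: block_swap 0 1];
      simple_level (tIpq 4 4) [::]].

Lemma tests17 : [&& all (wf_tab 8) gens17, group_test (tab_span gens17) &
  chain_test gens17 (tab_span gens17) [::] levels17].
Proof. by []. Qed.

Lemma tests18 : [&& all (wf_tab 8) gens18, group_test (tab_span gens18) &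
  chain_test gens18 (tab_span gens18) [::] levels18].
Proof. by []. Qed.

Lemma tests19 : [&& all (wf_tab 8) gens19, group_test (tab_span gens19) &
  chain_test gens19 (tab_span gens19) [::] levels19].
Proof. by []. Qed.

Lemma tests20 : [&& all (wf_tab 8) gens20, group_test (tab_span gens20) &
  chain_test gens20 (tab_span gens20) [::] levels20].
Proof. by []. Qed.

End Blocks.

(** * The given subgroups on tables, and W(F13) *)

Section GivenSubgroups.
Local Open Scope ring_scope.
Local Open Scope classical_set_scope.
Variable R : realType.
Local Notation Ad_tab := (Ad_tab R).
Local Notation aut := (aut_so R 8).

Lemma AdPO_gen (l : seq (ortho R 8)) (gens : seq (seq (bool * nat))) :
  l = map (orth_tab R 8) gens ->
  @AdPO R 8 @` gen [set a | a \in map (@cls R 8) l] = tab_group gens.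
Proof.
move=> ->; rewrite (image_gen _ (@AdPO_M R 8)); congr gen; apply/seteqP; split=> x /=.
  by move=> [_ /mapP[_ /mapP[m mg ->] ->] <-]; rewrite AdPO_cls; exact: map_f.
move=> /mapP[m mg ->]; exists (cls (orth_tab R 8 m)); last exact: AdPO_cls.
by apply: map_f; exact: map_f.
Qed.

Lemma orth_tab_blkI : Ipq 1 1 = orth_tab R 2 blkI. Proof. exact: orth_tab_Ipq. Qed.
Lemma orth_tab_blkP : Jn' 1 = orth_tab R 2 blkP. Proof. exact: orth_tab_Jn'. Qed.
Lemma orth_tab_blkJ : Jn 1 = orth_tab R 2 blkJ. Proof. exact: orth_tab_Jn. Qed.

Lemma orth_tab_blocks a b c d : wf_tab 2 a -> wf_tab 2 b -> wf_tab 2 c -> wf_tab 2 d ->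
  ortho_diag4 (orth_tab R 2 a) (orth_tab R 2 b) (orth_tab R 2 c) (orth_tab R 2 d) =
  orth_tab R 8 (blocks a b c d).
Proof.
by move=> wa wb wc wd; rewrite /ortho_diag4 !orth_tab_diag // (wf_mdiag wa wb, wf_mdiag wc wd).
Qed.

Lemma F17_tab_group : @AdPO R 8 @` @F17 R = tab_group gens17.
Proof.
rewrite -(AdPO_gen (l := [:: Ipq 4 4; Ipq 2 6; Ipq 6 2;
   ortho_diag4 (Ipq 1 1) (Ipq 1 1) (Ipq 1 1) (Ipq 1 1);
   ortho_diag4 (Jn' 1) (Jn' 1) (Jn' 1) (Jn' 1)])) //=.
rewrite !orth_tab_blkI !orth_tab_blkP !orth_tab_blocks //;
  by rewrite (orth_tab_Ipq R 4 4) (orth_tab_Ipq R 2 6) (orth_tab_Ipq R 6 2).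
Qed.

Lemma F18_tab_group : @AdPO R 8 @` @F18 R = tab_group gens18.
Proof.
rewrite -(AdPO_gen (l := [:: Ipq 4 4; Ipq 2 6; Ipq 6 2;
   ortho_diag4 (Ipq 1 1) (Ipq 1 1) (Ipq 1 1) (Ipq 1 1);
   ortho_diag4 (Jn' 1) (Jn' 1) (Jn' 1) (Jn 1)])) //=.
rewrite !orth_tab_blkI !orth_tab_blkP !orth_tab_blkJ !orth_tab_blocks //;
  by rewrite (orth_tab_Ipq R 4 4) (orth_tab_Ipq R 2 6) (orth_tab_Ipq R 6 2).
Qed.

Lemma F19_tab_group : @AdPO R 8 @` @F19 R = tab_group gens19.
Proof.
rewrite -(AdPO_gen (l := [:: Ipq 4 4; Ipq 2 6; Ipq 6 2;
   ortho_diag4 (Ipq 1 1) (Ipq 1 1) (Ipq 1 1) (Ipq 1 1);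
   ortho_diag4 (Jn' 1) (Jn' 1) (Jn 1) (Jn 1)])) //=.
rewrite !orth_tab_blkI !orth_tab_blkP !orth_tab_blkJ !orth_tab_blocks //;
  by rewrite (orth_tab_Ipq R 4 4) (orth_tab_Ipq R 2 6) (orth_tab_Ipq R 6 2).
Qed.

Lemma F20_tab_group : @AdPO R 8 @` @F20 R = tab_group gens20.
Proof.
rewrite -(AdPO_gen (l := [:: Ipq 4 4; Ipq 2 6; Ipq 6 2;
   ortho_diag4 (Ipq 1 1) (Ipq 1 1) (Ipq 1 1) (Jn 1);
   ortho_diag4 (Jn' 1) (Jn' 1) (Jn 1) (Ipq 1 1)])) //=.
rewrite !orth_tab_blkI !orth_tab_blkP !orth_tab_blkJ !orth_tab_blocks //;
  by rewrite (orth_tab_Ipq R 4 4) (orth_tab_Ipq R 2 6) (orth_tab_Ipq R 6 2).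
Qed.

Definition gens13 : seq (seq (bool * nat)) :=
  [:: tIpq 4 4; manti 4 (mconst false 4) (mconst false 4);
      mdiag 4 (tIpq 2 2) (tIpq 2 2);
      mdiag 4 (manti 2 (mconst false 2) (mconst false 2))
              (manti 2 (mconst false 2) (mconst false 2));
      all_blocks blkI; all_blocks blkP].

Lemma F13_tab_group : @AdPO R 8 @` @F13 R = tab_group gens13.
Proof.
rewrite -(AdPO_gen (l := [:: Ipq 4 4; Jn' 4; ortho_diag (Ipq 2 2) (Ipq 2 2);
   ortho_diag (Jn' 2) (Jn' 2);
   ortho_diag4 (Ipq 1 1) (Ipq 1 1) (Ipq 1 1) (Ipq 1 1);
   ortho_diag4 (Jn' 1) (Jn' 1) (Jn' 1) (Jn' 1)])) //=.
rewrite !orth_tab_blkI !orth_tab_blkP !orth_tab_blocks //.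
rewrite (orth_tab_Ipq R 4 4) (orth_tab_Jn' R 4).
by rewrite (orth_tab_Ipq R 2 2) (orth_tab_Jn' R 2) !orth_tab_diag.
Qed.

(** A word is a list of pairs of indices, read as a product of diagonal matrices and as
    the product of the images of these under [triality]. *)
Definition flip_word (w : seq (nat * nat)) :=
  foldr (fun p m => mmul (flip2 p.1 p.2) m) (mconst false 8) w.
Definition biv_word (w : seq (nat * nat)) :=
  foldr (fun p m => mmul (cliff_biv p.1 p.2) m) (mconst false 8) w.
Definition good_word (w : seq (nat * nat)) :=
  all (fun p => [&& p.1 < 8, p.2 < 8 & p.1 != p.2]%N) w.

Lemma triality_word w : good_word w ->
  [/\ wf_tab 8 (flip_word w), wf_tab 8 (biv_word w) &
      cj (triality R) (Ad_tab (flip_word w)) = Ad_tab (biv_word w)].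
Proof.
elim: w => [_|[k l] w IH /andP[/and3P[k8 l8 kl] /IH[wf_f wf_c rw]]].
  by split=> //; rewrite [flip_word _]/= [biv_word _]/= Ad_tab1 cj1.
rewrite -[flip_word (_ :: _)]/(mmul (flip2 k l) (flip_word w)).
rewrite -[biv_word (_ :: _)]/(mmul (cliff_biv k l) (biv_word w)).
have wc : wf_tab 8 (cliff_biv k l) by exact: (wf_cliff_biv (Ordinal k8) (Ordinal l8)).
split; [by apply: wf_mmul => //; exact: wf_flip2 | exact: wf_mmul |].
rewrite (Ad_tabM _ (wf_flip2 k l) wf_f) (Ad_tabM _ wc wf_c) cjM rw; congr (_ * _)%g.
exact: (@triality_flip2 R (Ordinal k8) (Ordinal l8)).
Qed.

Lemma trialityV : (triality R)^-1%g = triality R.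
Proof. by apply: (mulgI (triality R)); rewrite mulgV triality2. Qed.

Lemma cj_trialityK : involutive (cj (triality R)).
Proof. by move=> x; rewrite -{1}trialityV cjK. Qed.

Definition word_pairs ws := [seq (flip_word w, biv_word w) | w <- ws].
Definition swap_pairs ws := [seq (biv_word w, flip_word w) | w <- ws].

Lemma word_pairsP ws : all good_word ws ->
  all (fun p => wf_tab 8 p.1 && wf_tab 8 p.2) (word_pairs ws) /\
  {in word_pairs ws, forall p, cj (triality R) (Ad_tab p.1) = Ad_tab p.2}.
Proof.
move=> /allP gw; split.
  by apply/allP => _ /mapP[w /gw /triality_word[wf1 wf2 _] ->] /=; rewrite wf1.
by move=> _ /mapP[w /gw /triality_word[_ _ e] ->].
Qed.

Lemma swap_pairsP ws : all good_word ws ->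
  all (fun p => wf_tab 8 p.1 && wf_tab 8 p.2) (swap_pairs ws) /\
  {in swap_pairs ws, forall p, cj (triality R) (Ad_tab p.1) = Ad_tab p.2}.
Proof.
move=> /allP gw; split.
  by apply/allP => _ /mapP[w /gw /triality_word[wf1 wf2 _] ->] /=; rewrite wf1 wf2.
by move=> _ /mapP[w /gw /triality_word[_ _ e] ->] /=; rewrite -e cj_trialityK.
Qed.

Definition words13 : seq (seq (nat * nat)) := [seq [:: (0, k)%N] | k <- iota 1 7].

Lemma words13_tests :
  [&& all (wf_tab 8) gens13, all good_word words13,
      all (fun g => has (eq_pm g) (tab_span (map fst (word_pairs words13)))) even_flips,
      all (fun p => has (eq_pm p.2) (tab_span gens13)) (word_pairs words13),
      all (fun g => has (eq_pm g) (tab_span (map fst (swap_pairs words13)))) gens13 &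
      all (fun p => has (eq_pm p.2) (tab_span even_flips)) (swap_pairs words13)].
Proof. by []. Qed.

Lemma evenG_F13 x : @evenG R x <-> tab_group gens13 (cj (triality R) x).
Proof.
have /and5P[w13 gw t1 t2 /andP[t3 t4]] := words13_tests.
have [wp pE] := word_pairsP gw; have [wq qE] := swap_pairsP gw.
split; first exact: gen_pairs wp w13 pE t1 t2 x.
by rewrite -{2}[x]cj_trialityK; apply: gen_pairs wq _ qE t3 t4 _.
Qed.

Lemma weyl_F13_F22 : group_isom (WG (@F13 R)) (WG (@F22 R)).
Proof.
rewrite /WG F13_tab_group -/(@diagG R); apply: group_isom_sym.
have [FN FC] := normalizer_transport evenG_F13.
apply: (group_isom_weyl (h := triality R)) => g; first by rewrite -normalizer_evenG FN.
by rewrite -centralizer_evenG FC.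
Qed.

Lemma weyl_F22 : group_isom (WG (@F22 R)) {perm 'I_8}.
Proof. exact: weyl_diagG. Qed.
End GivenSubgroups.

(** * Normalising matrices with irrational entries *)

Section HalfTurn.
Local Open Scope ring_scope.
Variable R : realType.
Local Notation Ad_tab := (Ad_tab R).
Local Notation aut := (aut_so R 8).
Local Notation table := (seq (bool * nat)).

(** A reflection that exchanges the axes of the reflections I_(1,1) and J'_1. *)
Definition half_mx : 'M[R]_2 := (Num.sqrt 2)^-1 *: (mono_mx R 2 blkI + mono_mx R 2 blkP).

Let invol_tr m : wf_tab 2 m -> mmul m m = mconst false 2 ->
  (mono_mx R 2 m)^T = mono_mx R 2 m.
Proof.
move=> wm mm; have /eqP o := mono_mx_trE R wm; have /mulmx1C oT := o.
have m2 : mono_mx R 2 m *m mono_mx R 2 m = 1%:M.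
  by rewrite -mono_mxM // mm mono_mx_const expr0 scale1r.
by rewrite -[LHS]mulmx1 -m2 mulmxA oT mul1mx.
Qed.

Lemma half_tr : half_mx^T = half_mx.
Proof.
rewrite /half_mx; set c := _^-1.
have -> (A : 'M[R]_2) : (c *: A)^T = c *: A^T by apply/matrixP => i j; rewrite !mxE.
by rewrite raddfD /= !invol_tr.
Qed.

Lemma half_mul : half_mx *m half_mx = 1%:M.
Proof.
rewrite /half_mx -scalemxAl -scalemxAr scalerA mulmxDl !mulmxDr -!mono_mxM //.
have -> : mmul blkP blkI = mneg (mmul blkI blkP) by [].
rewrite mono_mx_mneg // addrA addrK.
have -> : mmul blkI blkI = mconst false 2 by [].
have -> : mmul blkP blkP = mconst false 2 by [].
rewrite mono_mx_const expr0 scale1r -mulr2n -scaler_nat scalerA -invfM -expr2 sqr_sqrtr //.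
by rewrite mulVf ?scale1r // pnatr_eq0.
Qed.

Fact half_orth : half_mx *m half_mx^T == 1%:M.
Proof. by rewrite half_tr half_mul. Qed.

Definition half : ortho R 2 := Ortho half_orth.

Definition half_image (a : table) : table :=
  if a == blkI then blkP else if a == blkP then blkI else a.

Definition letters : seq table := [:: blk1; mconst true 2; blkI; blkP].

Lemma wf_letters : all (wf_tab 2) letters. Proof. by []. Qed.

Lemma half_image_letter : {in letters, forall a, half_image a \in letters}.
Proof. by apply/allP. Qed.

(** Either the two terms of [half_mx] are exchanged or each is preserved. *)
Lemma half_conj : {in letters, forall a,
  (half * orth_tab R 2 a)%g = (orth_tab R 2 (half_image a) * half)%g}.
Proof.
move=> a al; have wa := allP wf_letters _ al.
have wa' := allP wf_letters _ (half_image_letter al).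
apply: val_inj; rewrite /= !val_orth_tab // /half_mx -scalemxAl -scalemxAr mulmxDl mulmxDr.
rewrite -!mono_mxM //; congr (_ *: _).
have test : all (fun a => let a' := half_image a in
    (mmul blkI a == mmul a' blkI) && (mmul blkP a == mmul a' blkP)
    || (mmul blkI a == mmul a' blkP) && (mmul blkP a == mmul a' blkI)) letters by [].
by have /orP[] := allP test _ al => /andP[/eqP -> /eqP ->] //; rewrite addrC.
Qed.

Lemma ortho_diagM p q (X X' : ortho R p) (Y Y' : ortho R q) :
  (ortho_diag X Y * ortho_diag X' Y')%g = ortho_diag (X * X')%g (Y * Y')%g.
Proof.
by apply: val_inj; rewrite /= mulmx_block !mulmx0 !mul0mx !addr0 !add0r.
Qed.

Lemma ortho_diag1 p q : ortho_diag (1%g : ortho R p) (1%g : ortho R q) = 1%g.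
Proof. by apply: val_inj; rewrite /= -scalar_mx_block. Qed.

Lemma half2 : (half * half)%g = 1%g.
Proof. by apply: val_inj; rewrite /= half_mul. Qed.

Lemma swap_diag p (X Y : ortho R p) :
  (Jn' p * ortho_diag X Y)%g = (ortho_diag Y X * Jn' p)%g.
Proof.
apply: val_inj; rewrite /= !mulmx_block !mulmx0 !mul0mx !mul1mx !mulmx1.
by rewrite !addr0 !add0r.
Qed.

Lemma swap2 p : (Jn' p * Jn' p)%g = 1%g :> ortho R (p + p).
Proof.
apply: val_inj; rewrite /= !mulmx_block !mulmx0 !mul0mx !mul1mx.
by rewrite !addr0 !add0r -scalar_mx_block.
Qed.

(** The first exchanges the last two generators of F17; the second, with its swap of
    the last two blocks, does so for F20. *)
Definition half17_orth : ortho R (2 + 2 + (2 + 2)) := ortho_diag4 half half half half.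
Definition half20_orth : ortho R (2 + 2 + (2 + 2)) :=
  ortho_diag (ortho_diag half half) (Jn' 2).

Definition half17 : aut := Ad (half17_orth : ortho R 8).
Definition half20 : aut := Ad (half20_orth : ortho R 8).

Lemma half17_2 : (half17 * half17)%g = 1%g.
Proof.
have e : (half17_orth * half17_orth)%g = 1%g.
  by rewrite /half17_orth /ortho_diag4 !ortho_diagM !half2 !ortho_diag1.
by rewrite -AdM -(Ad1 R 8); congr Ad; exact: e.
Qed.

Lemma half20_2 : (half20 * half20)%g = 1%g.
Proof.
have e : (half20_orth * half20_orth)%g = 1%g.
  by rewrite /half20_orth !ortho_diagM !half2 swap2 !ortho_diag1.
by rewrite -AdM -(Ad1 R 8); congr Ad; exact: e.
Qed.

Lemma half17_blocks a b c d :
  a \in letters -> b \in letters -> c \in letters -> d \in letters ->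
  cj half17 (Ad_tab (blocks a b c d)) =
  Ad_tab (blocks (half_image a) (half_image b) (half_image c) (half_image d)).
Proof.
move=> al bl cliff dl.
have w x : x \in letters -> wf_tab 2 x /\ wf_tab 2 (half_image x).
  by move=> xl; split; apply: (allP wf_letters) => //; exact: half_image_letter.
have [[wa wa'] [wb wb']] := (w _ al, w _ bl); have [[wc wc'] [wd wd']] := (w _ cliff, w _ dl).
have e : (half17_orth *
    ortho_diag4 (orth_tab R 2 a) (orth_tab R 2 b) (orth_tab R 2 c) (orth_tab R 2 d))%g =
    (ortho_diag4 (orth_tab R 2 (half_image a)) (orth_tab R 2 (half_image b))
       (orth_tab R 2 (half_image c)) (orth_tab R 2 (half_image d)) * half17_orth)%g.
  by rewrite /half17_orth /ortho_diag4 !ortho_diagM !half_conj.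
by apply: cj_eqP; rewrite /Ad_tab -!AdM -!orth_tab_blocks //; congr Ad; exact: e.
Qed.

Lemma half20_blocks a b c d :
  a \in letters -> b \in letters -> wf_tab 2 c -> wf_tab 2 d ->
  cj half20 (Ad_tab (blocks a b c d)) = Ad_tab (blocks (half_image a) (half_image b) d c).
Proof.
move=> al bl wc wd.
have w x : x \in letters -> wf_tab 2 x /\ wf_tab 2 (half_image x).
  by move=> xl; split; apply: (allP wf_letters) => //; exact: half_image_letter.
have [[wa wa'] [wb wb']] := (w _ al, w _ bl).
have e : (half20_orth *
    ortho_diag4 (orth_tab R 2 a) (orth_tab R 2 b) (orth_tab R 2 c) (orth_tab R 2 d))%g =
    (ortho_diag4 (orth_tab R 2 (half_image a)) (orth_tab R 2 (half_image b))
       (orth_tab R 2 d) (orth_tab R 2 c) * half20_orth)%g.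
  by rewrite /half20_orth /ortho_diag4 !ortho_diagM !half_conj // swap_diag.
by apply: cj_eqP; rewrite /Ad_tab -!AdM -!orth_tab_blocks //; congr Ad; exact: e.
Qed.

Lemma involution_normalises gens (f : table -> table) h :
  (h * h)%g = 1%g -> all (wf_tab 8) gens ->
  {in gens, forall m, cj h (Ad_tab m) = Ad_tab (f m)} ->
  all (fun m => has (eq_pm (f m)) (tab_span gens)) gens ->
  h \in normalizer (@tab_group R gens).
Proof.
move=> h2 wg hf /allP t; apply: normalizer_gen_inv => // _ /mapP[m mg ->].
rewrite hf //; have /hasP[e es fe] := t _ mg.
rewrite (Ad_tab_eq_pm R (allP (wf_span wg) _ es) fe); exact: tab_span_gen.
Qed.
End HalfTurn.

(** * The orders of W(F17), W(F18) and W(F20) *)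

Section Cardinals.
Local Open Scope ring_scope.
Variable R : realType.
Local Notation Ad_tab := (Ad_tab R).
Local Notation aut := (aut_so R 8).
Local Notation table := (seq (bool * nat)).
Local Notation blkN := (mconst true 2).

Lemma fixing1 gens pre : fixing gens pre (1%g : aut).
Proof. by split=> [|x _]; [exact: normalizer1 | exact: cj1l]. Qed.

Lemma simple_special gens pre s m ls : specials R gens (s :: pre) ls ->
  specials R gens pre (simple_level s m :: ls).
Proof.
move=> sp; split=> // x; rewrite inE => /eqP ->.
by exists 1%g; [exact: fixing1 | exact: cj1l].
Qed.

Lemma triality_normalises ws gens : all (wf_tab 8) gens -> all good_word ws ->
  (let ps := word_pairs ws ++ swap_pairs ws in
   all (fun m => has (eq_pm m) (tab_span (map fst ps))) gens &&
   all (fun p => has (eq_pm p.2) (tab_span gens)) ps) ->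
  triality R \in normalizer (tab_group gens).
Proof.
move=> wg gw /= /andP[t1 t2].
have [wp pE] := word_pairsP R gw; have [wq qE] := swap_pairsP R gw.
have N x : tab_group gens x -> tab_group gens (cj (triality R) x).
  apply: gen_pairs _ wg _ t1 t2 x; first by rewrite all_cat wp.
  by move=> p; rewrite mem_cat => /orP[/pE|/qE].
by apply: normalizer_intro => // x; rewrite trialityV; exact: N.
Qed.

(** The diagonal members of F17 that [triality] keeps in F17: sign changes of blocks,
    and D.  With their images they generate F17. *)
Definition words17 : seq (seq (nat * nat)) :=
  [:: [:: (0, 1)]; [:: (2, 3)]; [:: (4, 5)]; [:: (0, 2); (4, 6)]]%N.

Lemma half17_gens m : m \in gens17 ->
  cj (half17 R) (Ad_tab m) =
  Ad_tab (if m == all_blocks blkI then all_blocks blkP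
          else if m == all_blocks blkP then all_blocks blkI else m).
Proof.
rewrite !inE => /or4P[|||/orP[]] /eqP ->.
- by rewrite -[tIpq 4 4]/(blocks blkN blkN blk1 blk1) half17_blocks.
- by rewrite -[tIpq 2 6]/(blocks blkN blk1 blk1 blk1) half17_blocks.
- by rewrite -[tIpq 6 2]/(blocks blkN blkN blkN blk1) half17_blocks.
- by rewrite half17_blocks.
by rewrite half17_blocks.
Qed.

Lemma half17_normalises : half17 R \in normalizer (tab_group gens17).
Proof.
exact: (involution_normalises (half17_2 R) _ half17_gens).
Qed.

Lemma half20_gens m : m \in gens20 ->
  cj (half20 R) (Ad_tab m) =
  Ad_tab (if m == blocks blkI blkI blkI blkJ then blocks blkP blkP blkJ blkI
          else if m == blocks blkP blkP blkJ blkI then blocks blkI blkI blkI blkJ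
          else if m == tIpq 6 2 then blocks blkN blkN blk1 blkN else m).
Proof.
rewrite !inE => /or4P[|||/orP[]] /eqP ->.
- by rewrite -[tIpq 4 4]/(blocks blkN blkN blk1 blk1) half20_blocks.
- by rewrite -[tIpq 2 6]/(blocks blkN blk1 blk1 blk1) half20_blocks.
- by rewrite -[tIpq 6 2]/(blocks blkN blkN blkN blk1) half20_blocks.
- by rewrite half20_blocks.
by rewrite half20_blocks.
Qed.

Lemma half20_normalises : half20 R \in normalizer (tab_group gens20).
Proof.
exact: (involution_normalises (half20_2 R) _ half20_gens).
Qed.

Lemma words17_tests : all good_word words17 &&
  (let ps := word_pairs words17 ++ swap_pairs words17 in
   all (fun m => has (eq_pm m) (tab_span (map fst ps))) gens17 &&
   all (fun p => has (eq_pm p.2) (tab_span gens17)) ps).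
Proof. by []. Qed.

Lemma triality_tI26 : cj (triality R) (Ad_tab (tIpq 2 6)) = Ad_tab (all_blocks blkJ).
Proof.
rewrite (Ad_tab_eq_pm R (isT : wf_tab 8 (flip2 0 1)) (isT : eq_pm (tIpq 2 6) (flip2 0 1))).
rewrite -(Ad_tab_eq_pm R (isT : wf_tab 8 (all_blocks blkJ))
                         (isT : eq_pm (cliff_biv 0 1) (all_blocks blkJ))).
exact: (@triality_flip2 R (@Ordinal 8 0 isT) (@Ordinal 8 1 isT)).
Qed.

Lemma special_two gens pre s x m ls (h : aut) :
  fixing gens pre h -> cj h (Ad_tab s) = Ad_tab x ->
  specials R gens (s :: pre) ls ->
  specials R gens pre (Level s [:: s; x] [::] m :: ls).
Proof.
move=> hp hx sp; split=> // y; rewrite !inE => /orP[] /eqP ->; last by exists h.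
by exists 1%g; [exact: fixing1 | exact: cj1l].
Qed.

Lemma card_F18 : ([set: WG (@F18 R)] #= `I_(3 * 2 ^ 7)%N)%card.
Proof.
rewrite /WG F18_tab_group; have /and3P[wg gt ct] := tests18.
have := chain_test_card (R := R) wg gt ct.
have -> : foldr muln 1%N (orbit_sizes (tab_span gens18) [::] levels18) = (3 * 2 ^ 7)%N by [].
by apply; do 4!apply: simple_special.
Qed.

Lemma card_F17 : ([set: WG (@F17 R)] #= `I_(3 ^ 2 * 2 ^ 10)%N)%card.
Proof.
rewrite /WG F17_tab_group; have /and3P[wg gt ct] := tests17.
have := chain_test_card (R := R) wg gt ct.
have -> : foldr muln 1%N (orbit_sizes (tab_span gens17) [::] levels17) =
  (3 ^ 2 * 2 ^ 10)%N by [].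
apply; apply: (@special_two _ _ _ _ _ _ (triality R)) triality_tI26 _.
  have /andP[gw ps] := words17_tests.
  by split; [exact: triality_normalises wg gw ps | move=> x].
do 2!apply: simple_special.
apply: (@special_two _ _ _ _ _ _ (half17 R)); last by apply: simple_special.
  split; first exact: half17_normalises.
  by move=> y; rewrite !inE => /or3P[] /eqP ->; rewrite half17_gens.
by rewrite half17_gens.
Qed.

Lemma card_F20 : ([set: WG (@F20 R)] #= `I_(2 ^ 8)%N)%card.
Proof.
rewrite /WG F20_tab_group; have /and3P[wg gt ct] := tests20.
have := chain_test_card (R := R) wg gt ct.
have -> : foldr muln 1%N (orbit_sizes (tab_span gens20) [::] levels20) = (2 ^ 8)%N by [].
apply; apply: (@special_two _ _ _ _ _ _ (half20 R)); last by do 3!apply: simple_special.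
  by split; [exact: half20_normalises | move=> x].
by rewrite half20_gens.
Qed.
End Cardinals.

(** * The order of W(F19) *)

Section BracketObstruction.
Local Open Scope ring_scope.
Variable R : realType.
Local Notation Ad_tab := (Ad_tab R).
Local Notation aut := (aut_so R 8).
Local Notation so := (so R 8).
Local Notation table := (seq (bool * nat)).
Implicit Types (A u w : so) (m : table) (i j k l : 'I_8).

Lemma Ad_tab_elem m i j k l (s t : bool) : wf_tab 8 m ->
  row_of m i = (s, k : nat) -> row_of m j = (t, l : nat) ->
  Ad_tab m (elem_so R k l) = ((-1) ^+ s * (-1) ^+ t) *: elem_so R i j.
Proof.
move=> wm ri rj; apply: val_inj; apply/matrixP => a b.
rewrite -[LHS]/(so_mx (Ad_tab m (elem_so R k l)) a b) -[RHS]/(so_mx _ a b) so_mxZ [RHS]mxE.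
pose a' := Ordinal (wf_lt wm (ltn_ord a)); pose b' := Ordinal (wf_lt wm (ltn_ord b)).
have ra : row_of m a = ((row_of m a).1, a' : nat) by exact: surjective_pairing.
have rb : row_of m b = ((row_of m b).1, b' : nat) by exact: surjective_pairing.
rewrite (Ad_tab_entry _ wm ra rb).
have row_eq (c d : 'I_8) (x : 'I_8) r : row_of m d = (r, x : nat) ->
    (Ordinal (wf_lt wm (ltn_ord c)) == x) = (c == d).
  move=> rd; apply/eqP/eqP => [e|->]; last first.
    by apply: val_inj; rewrite -[LHS]/((row_of m d).2) rd.
  by apply/val_inj/(wf_inj wm (ltn_ord _) (ltn_ord _)); rewrite rd; exact: (congr1 val e).
rewrite !elem_soE !(row_eq _ _ _ _ ri) !(row_eq _ _ _ _ rj).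
pose sg (d : 'I_8) := (row_of m d).1; rewrite -/(sg a) -/(sg b).
have {ri}ri : sg i = s by rewrite /sg ri.
have {rj}rj : sg j = t by rewrite /sg rj.
case: (eqVneq a i) => [->|ai] /=.
  case: (eqVneq b j) => [->|bj] /=; first by rewrite ri rj.
  case: (eqVneq i j) => [ij|ij] /=; last by rewrite subrr !mulr0.
  case: (eqVneq b i) => [bi|bi]; last by rewrite subrr !mulr0.
  by rewrite bi ij eqxx in bj.
case: (eqVneq a j) => [->|aj] /=; last by rewrite subrr !mulr0.
case: (eqVneq b i) => [->|bi] /=; last by rewrite subrr !mulr0.
by rewrite ri rj [X in X * _]mulrC.
Qed.

Lemma eq_opp0 (x : R) : x = - x -> x = 0.
Proof.
by move/eqP; rewrite -subr_eq0 opprK -mulr2n -mulr_natl mulf_eq0 pnatr_eq0 => /eqP.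
Qed.

Lemma cj_app (h a b : aut) (v : so) : cj h a = b -> b (h v) = h (a v).
Proof.
move=> <-; rewrite -[RHS]/((h * a)%g v) -[LHS]/((cj h a * h)%g v).
by rewrite /cj mulgVK.
Qed.

Local Notation f19 := (blocks blkP blkP blkJ blkJ).

Lemma f19_rows : all8 (fun a => all8 (fun b =>
  [&& (a < 4)%N, (b < 4)%N, a./2 == b./2 & a != b] ==> (row_of f19 a == (false, b)))).
Proof. by []. Qed.

Lemma I26_rows : all8 (fun a => row_of (tIpq 2 6) a == ((a < 2)%N, a)).
Proof. by []. Qed.

Lemma f19_sqr_rows : all8 (fun a => row_of (mmul f19 f19) a == ((4 <= a)%N, a)).
Proof. by []. Qed.

Definition o8 n (n8 : (n < 8)%N) : 'I_8 := Ordinal n8.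

(** Let [k] be the inverse of such an [h].  With indices from 0, E_45 and E_46 have a
    nonzero bracket.  The image [u] of the first is fixed by f = diag(J'_1, J'_1, J_1, J_1)
    and by the sign change of the first block; these conditions leave only entries
    with both indices at least 4.  The image [w] of the second is fixed by f^2 and
    negated by the sign change of the first block, which leaves only entries with
    both indices less than 4.  Hence [u] and [w] commute. *)
Lemma F19_excluded (h : aut) m : m \in [:: tIpq 6 2; mmul (tIpq 6 2) (tIpq 4 4)] ->
  cj h (Ad_tab f19) = Ad_tab f19 -> cj h (Ad_tab (tIpq 2 6)) <> Ad_tab m.
Proof.
move=> mE hf hm; pose k := h^-1%g.
have wm : wf_tab 8 m by move: mE; rewrite !inE => /orP[] /eqP ->.
have kf : cj k (Ad_tab f19) = Ad_tab f19 by rewrite -{1}hf cjK.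
have km : cj k (Ad_tab m) = Ad_tab (tIpq 2 6) by rewrite -hm cjK.
pose e4 := @o8 4 isT; pose e5 := @o8 5 isT; pose e6 := @o8 6 isT; pose e7 := @o8 7 isT.
have [s [r4 r5 r6]] : exists s, [/\ row_of m e4 = (s, e4 : nat),
    row_of m e5 = (s, e5 : nat) & row_of m e6 = (~~ s, e6 : nat)].
  by move: mE; rewrite !inE => /orP[] /eqP ->; exists true.
pose u := k (elem_so R e4 e5); pose w := k (elem_so R e4 e6).
have fu : Ad_tab f19 u = u.
  rewrite (cj_app _ kf) (Ad_tab_elem (i := e5) (j := e4) (s := true) (t := false)) //.
  by rewrite expr1 expr0 mulr1 scaleN1r -elem_soN.
have mu : Ad_tab (tIpq 2 6) u = u.
  rewrite (cj_app _ km) (Ad_tab_elem wm r4 r5) -signr_addb addbb expr0.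
  by rewrite scale1r.
have mw : Ad_tab (tIpq 2 6) w = - w.
  rewrite (cj_app _ km) (Ad_tab_elem wm r4 r6) -signr_addb addbN addbb expr1.
  by rewrite autZ scaleN1r.
have ffw : Ad_tab (mmul f19 f19) w = w.
  rewrite Ad_tabM // -[LHS]/(Ad_tab f19 (Ad_tab f19 w)) !(cj_app _ kf); congr (k _).
  rewrite (Ad_tab_elem (i := e5) (j := e7) (s := true) (t := true)) //.
  rewrite autZ (Ad_tab_elem (i := e4) (j := e6) (s := false) (t := false)) //.
  by rewrite scalerA !(expr0, expr1) mulrNN !mulr1 scale1r.
have ffu : Ad_tab (mmul f19 f19) u = u.
  by rewrite Ad_tabM // -[LHS]/(Ad_tab f19 (Ad_tab f19 u)) !fu.
have sgnE m' (S : pred nat) (v : so) i j : wf_tab 8 m' ->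
    all8 (fun a => row_of m' a == (S a, a)) ->
    so_mx (Ad_tab m' v) i j = (-1) ^+ (S i (+) S j) * v i j.
  move=> wm' rows; have /eqP ri := all8P rows i; have /eqP rj := all8P rows j.
  by rewrite (Ad_tab_entry _ wm' ri rj) signr_addb.
have u0 i j : (i < 4)%N -> u i j = 0.
  move=> i4; have [j4|j4] := ltnP j 4; last first.
    apply: eq_opp0; rewrite -{1}ffu (sgnE _ _ _ _ _ _ f19_sqr_rows) // j4.
    by rewrite leqNgt i4 expr1 mulN1r.
  have [ij|ij] := eqVneq (i : nat) j.
    by rewrite (val_inj ij); apply: eq_opp0; exact: so_antisym.
  have [bij|bij] := eqVneq (i < 2)%N (j < 2)%N; last first.
    apply: eq_opp0; rewrite -{1}mu (sgnE _ _ _ _ _ _ I26_rows) //.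
    by rewrite -negb_eqb bij expr1 mulN1r.
  have half_eq : i./2 == j./2.
    move: i4 j4 bij; case: (nat_of_ord i) => [|[|[|[|]]]] //;
      by case: (nat_of_ord j) => [|[|[|[|]]]].
  have ri : row_of f19 i = (false, j : nat).
    by apply/eqP/(implyP (all8P (all8P f19_rows i) j)); rewrite i4 j4 half_eq.
  have rj : row_of f19 j = (false, i : nat).
    apply/eqP/(implyP (all8P (all8P f19_rows j) i)).
    by rewrite i4 j4 (eqP half_eq) eqxx eq_sym.
  apply: eq_opp0; rewrite -{1}fu (Ad_tab_entry _ _ ri rj) // expr0 !mul1r.
  exact: so_antisym.
have w0 i j : (4 <= i)%N -> w i j = 0.
  move=> i4; have [j4|j4] := ltnP j 4.
    apply: eq_opp0; rewrite -{1}ffw (sgnE _ _ _ _ _ _ f19_sqr_rows) // i4.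
    by rewrite leqNgt j4 expr1 mulN1r.
  have nw : so_mx (- w) i j = - w i j by rewrite mxE.
  apply: eq_opp0; have := congr1 (fun v : so => v i j) mw.
  rewrite (sgnE _ _ _ _ _ _ I26_rows) //.
  have lt2 l : (4 <= l)%N -> (l < 2)%N = false by move=> l4; rewrite ltnNge (leq_trans _ l4).
  by rewrite !lt2 // expr0 mul1r nw.
have uw : u *m w = 0.
  apply/matrixP => i j; rewrite !mxE big1 // => l _.
  have [l4|l4] := ltnP l 4; last by rewrite (w0 l) ?mulr0.
  by rewrite so_antisym (u0 l) ?oppr0 ?mul0r.
have wu : w *m u = 0.
  apply/matrixP => i j; rewrite !mxE big1 // => l _.
  have [l4|l4] := ltnP l 4; first by rewrite (u0 l) ?mulr0.
  by rewrite (so_antisym w) (w0 l) ?oppr0 ?mul0r.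
have uw0 : lie u w = 0 by apply: val_inj; rewrite /= uw wu subrr.
have [_ /bij_inj kI _] := aut_soP k.
have : lie (elem_so R e4 e5) (elem_so R e4 e6) = 0.
  apply: kI; rewrite autL -/u -/w uw0.
  by rewrite -(scale0r (0 : so)) autZ !scale0r.
rewrite (elem_soN R e4 e5) => e.
have : lie (elem_so R e5 e4) (elem_so R e4 e6) = 0.
  apply: (oppr_inj); rewrite oppr0 -e; apply: val_inj => /=.
  by rewrite mulNmx mulmxN opprB opprK addrC.
by rewrite lie_elem //; apply: elem_so_neq0.
Qed.

Lemma special_excluded gens pre s xs ms ls :
  {in xs, forall x (h : aut), fixing gens pre h -> cj h (Ad_tab s) <> Ad_tab x} ->
  specials R gens (s :: pre) ls ->
  specials R gens pre (Level s [:: s] xs ms :: ls).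
Proof.
move=> hx sp; split=> // y; rewrite inE => /eqP ->.
by exists 1%g; [exact: fixing1 | exact: cj1l].
Qed.

Lemma card_F19 : ([set: WG (@F19 R)] #= `I_(2 ^ 9)%N)%card.
Proof.
rewrite /WG F19_tab_group; have /and3P[wg gt ct] := tests19.
have := chain_test_card (R := R) wg gt ct.
have -> : foldr muln 1%N (orbit_sizes (tab_span gens19) [::] levels19) = (2 ^ 9)%N by [].
apply; apply: simple_special; apply: special_excluded; last by do 2!apply: simple_special.
move=> x xE h [_ hp]; refine (F19_excluded xE _).
apply: hp; exact: mem_head.
Qed.
End BracketObstruction.

Local Open Scope classical_set_scope.
Local Open Scope card_scope.

Theorem proposition4p9 (R : realType) :
  [/\ [set: WG (@F17 R)] #= `I_(3 ^ 2 * 2 ^ 10)%N,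
      [set: WG (@F18 R)] #= `I_(3 * 2 ^ 7)%N,
      [set: WG (@F19 R)] #= `I_(2 ^ 9)%N &
      [set: WG (@F20 R)] #= `I_(2 ^ 8)%N] /\
  group_isom (WG (@F13 R)) (WG (@F22 R)) /\
  group_isom (WG (@F22 R)) {perm 'I_8}.
Proof.
split; first by split; [exact: card_F17|exact: card_F18|exact: card_F19|exact: card_F20].
by split; [exact: weyl_F13_F22|exact: weyl_F22].
Qed.
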